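(* Assume $\chi^{1+q}\neq1$. Then the space $\mathrm{Hom}_{G(V^\square)}\big(I_V(\chi),\ \mathrm{Ind}_{P^\square_X}^{G(V^\square)}(I_X(\chi)\boxtimes I_{V_0}(\chi))\big)$ is one-dimensional.
   Context: Let $\mathbb F$ be a finite field of odd cardinality $q$, $\mathbb E/\mathbb F$ an extension of degree $1$ or $2$ with Galois generator $x\mapsto\bar x$. Let $\mathcal C$ be an algebraically closed field of characteristic not dividing $q$; representations are on $\mathcal C$-vector spaces. An $\epsilon$-sesquilinear space $(V,\langle\cdot,\cdot\rangle_V)$ is a finite-dimensional $\mathbb E$-space with a pairing, additive in each variable, $\mathbb E$-linear in the first, with $\langle y,x\rangle=\epsilon_V\overline{\langle x,y\rangle}$, $\epsilon_V\in\{\pm1\}$ ($\epsilon_V=1$ if $\mathbb E\ne\mathbb F$); the form is assumed nondegenerate or identically zero. $G(V)$ is its isometry group ($=\mathrm{GL}_{\mathbb E}(V)$ for the zero form). Doubling: $V^\square=V^+\oplus V^-$ (two copies of $V$, $v\mapsto v^\pm$) with form $\langle v_1^++w_1^-,v_2^++w_2^-\rangle=\langle v_1,v_2\rangle-\langle w_1,w_2\rangle$; $V^\Delta=\{v^++v^-\}$, $V^\nabla=\{v^+-v^-\}$; $P_V\subset G(V^\square)$ is the stabilizer of $V^\Delta$. For a character $\chi:\mathbb E^\times\to\mathcal C^\times$ put $\chi^{-c}(x)=\chi(\bar x)^{-1}$ and $\chi^{1+q}(x)=\chi(x\bar x)$. The degenerate principal series $I_V(\chi)$ is the space of $f:G(V^\square)\to\mathcal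 C$ with $f(pg)=\chi(\det(p|_{V^\Delta}))f(g)$ for $p\in P_V$ if the form is nondegenerate, resp. $f(pg)=\chi(\det(p|_{V^\Delta}))\chi^{-c}(\det(p|_{V^\square/V^\Delta}))f(g)$ if the form is zero, with $G(V^\square)$ acting by right translation. For any $\mathbb E$-space $X$ with zero form, $I_X(\chi)$ is the analogous representation of $\mathrm{GL}_{\mathbb E}(X^\square)$. Parabolic setup: if the form on $V$ is nondegenerate, fix a decomposition $V=X\oplus V_0\oplus Y$ with $X,Y$ totally isotropic and in duality, $V_0=(X\oplus Y)^\perp$ nondegenerate; then $V^\square=X^\square\oplus V_0^\square\oplus Y^\square$ and $P^\square_X$ is the parabolic subgroup of $G(V^\square)$ stabilizing the flag $0\subset X^\square\subset X^\square\oplus V_0^\square\subset V^\square$, with Levi subgroup the stabilizer of $X^\square,V_0^\square,Y^\square$, identified with $\mathrm{GL}_{\mathbb E}(X^\square)\times G(V_0^\square)$. If the form on $V$ is zero, fix $V=X\oplus V_0$, and $P^\square_X\subset\mathrm{GL}(V^\square)$ is the stabilizer of $X^\square$ with Levi $\mathrm{GL}(X^\square)\times\mathrm{GL}(V_0^\square)$. Here $X$ carries the zero form and $V_0$ the restricted form. $\mathrm{Ind}$ is parabolic induction (inflate from the Levi, then induce). *)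

(* Defs.v *)
From HB Require Import structures.
From mathcomp Require Import all_boot all_order all_algebra.
Set Implicit Arguments. Unset Strict Implicit. Unset Printing Implicit Defensive.
Import GRing.Theory.
Local Open Scope ring_scope.

(* Conventions: vectors are ROW vectors, a group element g acts by x |-> x *m g.
   A sesquilinear form on E^n is given by its Gram matrix J:
      <x, y> = x *m J *m (map_mx s y)^T,
   where s : E -> E is the Galois involution x |-> xbar. *)

Definition sel {E : fieldType} (d N : nat) (f : nat -> nat) : 'M[E]_(d, N) :=
  \matrix_(i < d, j < N) ((j : nat) == f i)%:R.

Definition dbl_form {E : fieldType} {n : nat} (J : 'M[E]_n) : 'M[E]_(n + n) :=
  block_mx J 0 0 (- J).

(* Isometry group of the Gram matrix K (for K = 0: the whole GL). *)
Definition isom_grp {E : finFieldType} (s : {rmorphism E -> E}) {N : nat}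
  (K : 'M[E]_N) : {set 'M[E]_N} :=
  [set g | (g \in unitmx) && (g *m K *m (map_mx s g)^T == K)].

(* The diagonal V^Delta = {v^+ + v^-} inside V^square, as a row space. *)
Definition diagmx {E : fieldType} (n : nat) : 'M[E]_(n, n + n) :=
  row_mx 1%:M 1%:M.

Definition siegel {E : finFieldType} (s : {rmorphism E -> E}) {n : nat}
  (J : 'M[E]_n) : {set 'M[E]_(n + n)} :=
  [set p in isom_grp s (dbl_form J) | (diagmx n *m p <= diagmx n)%MS].

(* The character of P_V defining I_V(chi).  For p stabilizing V^Delta,
   diagmx *m p = r *m diagmx with r = matrix of p|_{V^Delta}; the determinant of
   p on V^square / V^Delta is det p / det r.  [zero] = the form is zero. *)
Definition ps_factor {E : finFieldType} {C : fieldType}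
  (s : {rmorphism E -> E}) (chi : E -> C) {n : nat} (zero : bool)
  (p : 'M[E]_(n + n)) : C :=
  let d1 := \det (lsubmx (diagmx n *m p)) in
  if zero then chi d1 * (chi (s (\det p / d1)))^-1 else chi d1.

Definition degPS {E : finFieldType} {C : fieldType}
  (s : {rmorphism E -> E}) (chi : E -> C) {n : nat} (J : 'M[E]_n)
  (f : {ffun 'M[E]_(n + n) -> C}) : Prop :=
  (forall g, g \notin isom_grp s (dbl_form J) -> f g = 0) /\
  (forall p g, p \in siegel s J -> f (p *m g) = ps_factor s chi (J == 0) p * f g).

(* Coordinates.  V = E^(k+m+ky) = X (+) V0 (+) Y with X = first k coordinates,
   V0 = next m, Y = last ky.  In V^square = E^(n+n) (first n coords = V^+, last
   n = V^-), X^square has basis x_i^+ (i<k) then x_i^-, similarly V0^square. *)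
Definition dpos (off sz n i : nat) : nat :=
  (if i < sz then off + i else n + off + (i - sz))%N.

Definition eXv {E : fieldType} (k m ky : nat) : 'M[E]_(k, k + m + ky) :=
  sel k (k + m + ky) id.
Definition eV0v {E : fieldType} (k m ky : nat) : 'M[E]_(m, k + m + ky) :=
  sel m (k + m + ky) (fun i => (k + i)%N).
Definition eYv {E : fieldType} (k m ky : nat) : 'M[E]_(ky, k + m + ky) :=
  sel ky (k + m + ky) (fun i => (k + m + i)%N).

Definition formV0 {E : fieldType} (k m ky : nat) (J : 'M[E]_(k + m + ky)) : 'M[E]_m :=
  eV0v k m ky *m J *m (eV0v k m ky)^T.

Definition eXd {E : fieldType} (k m ky : nat) : 'M[E]_(k + k, (k + m + ky) + (k + m + ky)) :=
  sel (k + k) _ (dpos 0 k (k + m + ky)).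
Definition eV0d {E : fieldType} (k m ky : nat) : 'M[E]_(m + m, (k + m + ky) + (k + m + ky)) :=
  sel (m + m) _ (dpos k m (k + m + ky)).

Definition parX {E : finFieldType} (s : {rmorphism E -> E}) (k m ky : nat)
  (J : 'M[E]_(k + m + ky)) : {set 'M[E]_((k + m + ky) + (k + m + ky))} :=
  [set p in isom_grp s (dbl_form J) |
     (eXd k m ky *m p <= eXd k m ky)%MS &&
     (col_mx (eXd k m ky) (eV0d k m ky) *m p <= col_mx (eXd k m ky) (eV0d k m ky))%MS].

(* Levi components of p in P^square_X: action on X^square and on
   (X^sq (+) V0^sq)/X^sq = V0^sq, in the above bases. *)
Definition levX {E : fieldType} (k m ky : nat)
  (p : 'M[E]_((k + m + ky) + (k + m + ky))) : 'M[E]_(k + k) :=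
  eXd k m ky *m p *m (eXd k m ky)^T.
Definition lev0 {E : fieldType} (k m ky : nat)
  (p : 'M[E]_((k + m + ky) + (k + m + ky))) : 'M[E]_(m + m) :=
  eV0d k m ky *m p *m (eV0d k m ky)^T.

(* Ind_{P_X^sq}^{G(V^sq)} (I_X(chi) [x] I_V0(chi)), realized as functions
   Phi(g, a, b) (g in G(V^sq), a in GL(X^sq), b in G(V0^sq)); for fixed g,
   (a, b) |-> Phi(g, a, b) lies in I_X(chi) [x] I_V0(chi) = functions on
   GL(X^sq) x G(V0^sq) in the corresponding spaces in each variable;
   the Levi acts by right translation, and Phi(pg) = sigma(p) Phi(g). *)
Definition indSpace {E : finFieldType} {C : fieldType}
  (s : {rmorphism E -> E}) (chi : E -> C) (k m ky : nat) (J : 'M[E]_(k + m + ky))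
  (Phi : {ffun 'M[E]_((k + m + ky) + (k + m + ky)) * 'M[E]_(k + k) * 'M[E]_(m + m) -> C})
  : Prop :=
  let J0 := formV0 J in
  (forall g a b, ~~ [&& g \in isom_grp s (dbl_form J),
                        a \in isom_grp s (dbl_form (0 : 'M[E]_k))
                      & b \in isom_grp s (dbl_form J0)] -> Phi (g, a, b) = 0) /\
  (forall g a b a', a' \in siegel s (0 : 'M[E]_k) ->
      Phi (g, a' *m a, b) = ps_factor s chi true a' * Phi (g, a, b)) /\
  (forall g a b b', b' \in siegel s J0 ->
      Phi (g, a, b' *m b) = ps_factor s chi (J0 == 0) b' * Phi (g, a, b)) /\
  (forall g a b p, p \in parX s J ->
      Phi (p *m g, a, b) = Phi (g, a *m @levX _ k m ky p, b *m @lev0 _ k m ky p)).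

Definition intertwiner {E : finFieldType} {C : fieldType}
  (s : {rmorphism E -> E}) (chi : E -> C) (k m ky : nat) (J : 'M[E]_(k + m + ky))
  (T : {ffun 'M[E]_((k + m + ky) + (k + m + ky)) -> C} ->
       {ffun 'M[E]_((k + m + ky) + (k + m + ky)) * 'M[E]_(k + k) * 'M[E]_(m + m) -> C})
  : Prop :=
  (forall f, degPS s chi J f -> indSpace s chi J (T f)) /\
  (forall (c : C) f1 f2, degPS s chi J f1 -> degPS s chi J f2 ->
      T [ffun x => c * f1 x + f2 x] = [ffun y => c * T f1 y + T f2 y]) /\
  (forall h f, h \in isom_grp s (dbl_form J) -> degPS s chi J f ->
      T [ffun x => f (x *m h)] = [ffun y => T f ((y.1.1 *m h), y.1.2, y.2)]).

(* Main.v *)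
(** By Frobenius reciprocity and induction in stages, the intertwining space has a
    basis indexed by the double cosets [Q w P_V] on which two characters agree;
    here [Q] is the subgroup of the parabolic [P_X] whose Levi components lie in
    the Siegel subgroups of [X] and [V_0], with character [psi], and [P_V] carries
    the character defining [I_V(chi)].  The double coset of [w] is the [Q]-orbit of
    the subspace [L = V^Delta w^-1], and [Q] is the stabilizer of the flag
    [X^Delta <= X^sq <= M], where [M = X^sq + V_0^Delta].

    If [L :&: X^sq <= X^Delta], [X^Delta <= L] and [L :&: (X^sq + V_0^sq) <= M],
    then [L] meets [V^nabla] trivially, so it is the graph of a map
    [V^Delta -> V^nabla], and the corresponding unipotent element belongs to [Q]
    and maps [V^Delta] to [L].  This is the double coset of [1], on which the
    characters agree.  If one of the three inclusions fails at a vector [x],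
    choose [y] dual to [x] and let [q] scale [x] by [t] and [y] by [s(t)^-1],
    fixing their orthogonal complement (for the zero form: scale [x] only, fixing
    a hyperplane).  With a suitable [y], [q] lies in [Q] and stabilizes [L], and
    the two characters take there, in some order, the values [chi t] and
    [chi(s t)^-1], which differ for some [t] since [chi^(1+q)] is nontrivial. *)
Require Import Defs.
From HB Require Import structures.
From mathcomp Require Import all_boot all_order all_algebra ring zify.
Set Implicit Arguments. Unset Strict Implicit. Unset Printing Implicit Defensive.
Import GRing.Theory.
Local Open Scope ring_scope.

(** * Groups of matrices and their characters *)

Section MatrixGroups.
Variables (E : finFieldType) (C : fieldType).

Definition mxgroup n (H : {set 'M[E]_n}) : Prop :=
  [/\ 1%:M \in H, {in H &, forall x y, x *m y \in H},
      {in H, forall x, x \in unitmx} & {in H, forall x, invmx x \in H}].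

Definition mxchar n (H : {set 'M[E]_n}) (al : 'M[E]_n -> C) : Prop :=
  {in H &, forall x y, al (x *m y) = al x * al y} /\ {in H, forall x, al x != 0}.

Definition extend0 n (H : {set 'M[E]_n}) (al : 'M[E]_n -> C) x :=
  if x \in H then al x else 0.

Lemma invmx_mul n (x y : 'M[E]_n) : x \in unitmx -> y \in unitmx ->
  invmx (x *m y) = invmx y *m invmx x.
Proof.
move=> ux uy; have uxy : x *m y \in unitmx by rewrite unitmx_mul ux.
apply: (can_inj (mulKmx uxy)).
by rewrite mulmxV // mulmxA mulmxK // mulmxV.
Qed.

Section Group.
Variables (n : nat) (H : {set 'M[E]_n}).
Hypothesis gH : mxgroup H.

Lemma mxgroup1 : 1%:M \in H. Proof. by case: gH. Qed.
Lemma mxgroupM x y : x \in H -> y \in H -> x *m y \in H.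
Proof. by case: gH => _ + _ _; apply. Qed.
Lemma mxgroup_unit x : x \in H -> x \in unitmx.
Proof. by case: gH => _ _ + _; apply. Qed.
Lemma mxgroupV x : x \in H -> invmx x \in H.
Proof. by case: gH => _ _ _; apply. Qed.
Lemma mxgroupMl x y : x \in H -> (x *m y \in H) = (y \in H).
Proof.
move=> xH; apply/idP/idP => [xyH|]; last exact: mxgroupM.
by rewrite -(mulKmx (mxgroup_unit xH) y) mxgroupM // mxgroupV.
Qed.
Lemma mxgroupMr x y : y \in H -> (x *m y \in H) = (x \in H).
Proof.
move=> yH; apply/idP/idP => [xyH|xH]; last exact: mxgroupM.
by rewrite -(mulmxK (mxgroup_unit yH) x) mxgroupM // mxgroupV.
Qed.
Lemma mxgroup_invM x y : x \in H -> y \in H -> invmx (x *m y) = invmx y *m invmx x.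
Proof. by move=> /mxgroup_unit ux /mxgroup_unit uy; exact: invmx_mul. Qed.

Variable al : 'M[E]_n -> C.
Hypothesis chH : mxchar H al.

Lemma mxcharM x y : x \in H -> y \in H -> al (x *m y) = al x * al y.
Proof. by case: chH => + _; apply. Qed.
Lemma mxchar_neq0 x : x \in H -> al x != 0.
Proof. by case: chH => _; apply. Qed.
Lemma mxchar1 : al 1%:M = 1.
Proof.
have h1 := mxgroup1; apply: (mulfI (mxchar_neq0 h1)).
by rewrite -mxcharM // mulmx1 mulr1.
Qed.
Lemma mxcharV x : x \in H -> al (invmx x) = (al x)^-1.
Proof.
move=> xH; apply: (mulfI (mxchar_neq0 xH)).
by rewrite mulfV ?mxchar_neq0 // -mxcharM ?mxgroupV // mulmxV ?mxgroup_unit // mxchar1.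
Qed.
Lemma ext0_Ml x y : x \in H -> extend0 H al (x *m y) = al x * extend0 H al y.
Proof.
move=> xH; rewrite /extend0 mxgroupMl //; case: ifP => yH; last by rewrite mulr0.
exact: mxcharM.
Qed.
Lemma ext0_Mr x y : y \in H -> extend0 H al (x *m y) = extend0 H al x * al y.
Proof.
move=> yH; rewrite /extend0 mxgroupMr //; case: ifP => xH; last by rewrite mul0r.
exact: mxcharM.
Qed.

End Group.

(** * Canonical representatives of the cosets of [P :&: H] in [H] *)

Section Representatives.
Variables (n : nat) (H P : {set 'M[E]_n}).
Hypotheses (gH : mxgroup H) (gP : mxgroup P).

Definition coset_rep x := odflt x [pick y in H | y *m invmx x \in P].

Lemma coset_repP x : x \in H -> coset_rep x \in H /\ coset_rep x *m invmx x \in P.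
Proof.
move=> xH; rewrite /coset_rep; case: pickP => [y /andP[]//|/(_ x)].
by rewrite xH mulmxV ?(mxgroup_unit gH) // (mxgroup1 gP).
Qed.

Lemma coset_rep_eq x y : x \in H -> y \in H -> y *m invmx x \in P ->
  coset_rep y = coset_rep x.
Proof.
move=> xH yH yxP.
have E1 : [pick z in H | z *m invmx x \in P] = [pick z in H | z *m invmx y \in P].
  apply: eq_pick => z /=; congr (_ && _).
  have -> : z *m invmx x = z *m invmx y *m (y *m invmx x).
    by rewrite mulmxA mulmxKV // (mxgroup_unit gH).
  by rewrite (mxgroupMr gP).
rewrite /coset_rep E1; case: pickP => // /(_ y).
by rewrite yH mulmxV ?(mxgroup_unit gH) // (mxgroup1 gP).
Qed.

Lemma coset_rep_id x : x \in H -> coset_rep (coset_rep x) = coset_rep x.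
Proof. by move=> xH; have [h1 h2] := coset_repP xH; apply: coset_rep_eq. Qed.

(** Right translation by [h] permutes the cosets: [x |-> coset_rep (x *m h)] is a bijection of the
    representatives, with inverse given by [invmx h], and [F] does not see the change of
    representative. *)
Lemma sum_coset_shift (F : 'M[E]_n -> C) h :
  (forall r x, r \in P -> r \in H -> x \in H -> F (r *m x) = F x) -> h \in H ->
  \sum_(x in H | coset_rep x == x) F (x *m h) = \sum_(x in H | coset_rep x == x) F x.
Proof.
move=> FP hH; have uH := mxgroup_unit gH; have hH' := mxgroupV gH hH.
have Frep x : x \in H -> F (coset_rep x) = F x.
  move=> xH; have [rH rP] := coset_repP xH.
  rewrite -{1}(mulmxKV (uH _ xH) (coset_rep x)) FP //.
  by rewrite (mxgroupMr gH) ?(mxgroupV gH).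
have repM x y : x \in H -> y \in H ->
    coset_rep (coset_rep x *m y) = coset_rep (x *m y).
  move=> xH yH; have [rH rP] := coset_repP xH.
  apply: coset_rep_eq; rewrite ?(mxgroupM gH) //.
  by rewrite (mxgroup_invM gH) // mulmxA mulmxK // uH.
rewrite [RHS](reindex_onto (fun x => coset_rep (x *m h))
                           (fun x => coset_rep (x *m invmx h))) /=; last first.
  move=> x /andP[xH /eqP rx].
  by rewrite repM ?(mxgroupM gH) // mulmxKV ?uH.
apply: eq_big => x.
  apply/andP/andP => [[xH /eqP rx]|[/andP[rH rr] /eqP rx]].
    have xhH := mxgroupM gH xH hH; have [? _] := coset_repP xhH.
    by rewrite coset_rep_id // repM // mulmxK ?uH // rx !eqxx andbT; split.
  have xH : x \in H.
    by rewrite -rx; apply: (proj1 (coset_repP _)); rewrite (mxgroupM gH).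
  by split=> //; rewrite -{1}rx coset_rep_id ?(mxgroupM gH) // rx.
by move=> /andP[xH _]; rewrite Frep // (mxgroupM gH).
Qed.

End Representatives.
End MatrixGroups.

(** * Intertwiners and double cosets *)

Section Mackey.
Variables (E : finFieldType) (C : fieldType) (N dX d0 : nat).
Variables (G P R : {set 'M[E]_N}) (GX PX : {set 'M[E]_dX}) (G0 P0 : {set 'M[E]_d0}).
Variables (al : 'M[E]_N -> C) (alX : 'M[E]_dX -> C) (al0 : 'M[E]_d0 -> C).
Variables (lX : 'M[E]_N -> 'M[E]_dX) (l0 : 'M[E]_N -> 'M[E]_d0).

Hypotheses (gG : mxgroup G) (gP : mxgroup P) (gR : mxgroup R)
  (gGX : mxgroup GX) (gPX : mxgroup PX) (gG0 : mxgroup G0) (gP0 : mxgroup P0).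
Hypotheses (sPG : {subset P <= G}) (sRG : {subset R <= G})
  (sPX : {subset PX <= GX}) (sP0 : {subset P0 <= G0}).
Hypotheses (chP : mxchar P al) (chX : mxchar PX alX) (ch0 : mxchar P0 al0).
Hypotheses (lXG : {in R, forall p, lX p \in GX}) (l0G : {in R, forall p, l0 p \in G0}).
Hypotheses (lXM : {in R &, forall p q, lX (p *m q) = lX p *m lX q})
           (l0M : {in R &, forall p q, l0 (p *m q) = l0 p *m l0 q}).
Hypothesis compat : forall r, r \in P -> r \in R ->
  [/\ lX r \in PX, l0 r \in P0 & al r = alX (lX r) * al0 (l0 r)].
Hypothesis lift : forall a b, a \in GX -> b \in G0 ->
  exists2 p, p \in R & lX p = a /\ l0 p = b.
(** The first alternative puts [w] in the double coset of 1; the second forces every function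
    equivariant on both sides to vanish at [w]. *)
Hypothesis double_cosets : forall w, w \in G ->
  exists q, [/\ q \in R, lX q \in PX, l0 q \in P0 &
    q *m w \in P \/ (invmx w *m q *m w \in P /\
                     al (invmx w *m q *m w) <> alX (lX q) * al0 (l0 q))].

(** [inPS], [inInd] and [intertw] become [degPS], [indSpace] and [intertwiner] by unfolding once the
    data are instantiated. *)
Definition inPS (f : {ffun 'M[E]_N -> C}) : Prop :=
  (forall g, g \notin G -> f g = 0) /\
  (forall p g, p \in P -> f (p *m g) = al p * f g).

Definition inInd (Phi : {ffun 'M[E]_N * 'M[E]_dX * 'M[E]_d0 -> C}) : Prop :=
  (forall g a b, ~~ [&& g \in G, a \in GX & b \in G0] -> Phi (g, a, b) = 0) /\
  (forall g a b a', a' \in PX -> Phi (g, a' *m a, b) = alX a' * Phi (g, a, b)) /\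
  (forall g a b b', b' \in P0 -> Phi (g, a, b' *m b) = al0 b' * Phi (g, a, b)) /\
  (forall g a b p, p \in R -> Phi (p *m g, a, b) = Phi (g, a *m lX p, b *m l0 p)).

Definition intertw (T : {ffun 'M[E]_N -> C} ->
                        {ffun 'M[E]_N * 'M[E]_dX * 'M[E]_d0 -> C}) : Prop :=
  (forall f, inPS f -> inInd (T f)) /\
  (forall (c : C) f1 f2, inPS f1 -> inPS f2 ->
      T [ffun x => c * f1 x + f2 x] = [ffun y => c * T f1 y + T f2 y]) /\
  (forall h f, h \in G -> inPS f ->
      T [ffun x => f (x *m h)] = [ffun y => T f ((y.1.1 *m h), y.1.2, y.2)]).

(* A sum over representatives of the cosets [(P :&: R) p] in place of an average over
   [R], because [#|P :&: R|] may vanish in [C]. *)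
Definition mackey_op (f : {ffun 'M[E]_N -> C}) :
    {ffun 'M[E]_N * 'M[E]_dX * 'M[E]_d0 -> C} :=
  [ffun y => \sum_(p in R | coset_rep R P p == p)
     extend0 PX alX (y.1.2 *m invmx (lX p)) * extend0 P0 al0 (y.2 *m invmx (l0 p))
       * f (p *m y.1.1)].

(** The translates of this function span the principal series, so an intertwiner is determined by
    its image. *)
Definition ps_delta : {ffun 'M[E]_N -> C} := [ffun g => extend0 P al g].

Lemma ps_delta_in : inPS ps_delta.
Proof.
split=> [g gnG|p g pP]; rewrite !ffunE; last exact: ext0_Ml.
by rewrite /extend0; case: ifP => // /sPG; rewrite (negPf gnG).
Qed.

Lemma inPS_shift h f : h \in G -> inPS f -> inPS [ffun x => f (x *m h)].
Proof.
move=> hG [f0 fP]; split=> [g gG'|p g pP]; rewrite !ffunE; last by rewrite -mulmxA fP.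
by apply: f0; rewrite (mxgroupMr gG).
Qed.

Lemma inPS_lin c f1 f2 : inPS f1 -> inPS f2 -> inPS [ffun x => c * f1 x + f2 x].
Proof.
move=> [z1 p1] [z2 p2]; split=> [g gG'|p g pP]; rewrite !ffunE.
  by rewrite z1 // z2 // mulr0 addr0.
by rewrite p1 // p2 // mulrDr mulrCA.
Qed.

(** By [compat] the summand does not change when [p] is multiplied on the left by [P :&: R]. The sum
    therefore runs over cosets, and a translation by an element of [R] can be absorbed. *)
Lemma mackey_intertw : intertw mackey_op.
Proof.
split; last split.
- move=> f [f0 fP]; split; last split; last split.
  + move=> g a b; rewrite !negb_and => H; rewrite ffunE big1 //= => p /andP[pR _].
    case/or3P: H => H.
    * by rewrite f0 ?mulr0 // (mxgroupMl gG) // sRG.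
    * rewrite {1}/extend0 ifF ?mul0r //; apply: contraNF H => /sPX.
      by rewrite (mxgroupMr gGX) // (mxgroupV gGX) ?lXG.
    * rewrite {2}/extend0 ifF ?mulr0 ?mul0r //; apply: contraNF H => /sP0.
      by rewrite (mxgroupMr gG0) // (mxgroupV gG0) ?l0G.
  + move=> g a b a' a'P; rewrite !ffunE mulr_sumr; apply: eq_bigr => p _ /=.
    by rewrite -mulmxA (ext0_Ml gPX) // !mulrA.
  + move=> g a b b' b'P; rewrite !ffunE mulr_sumr; apply: eq_bigr => p _ /=.
    rewrite -[b' *m b *m _]mulmxA (ext0_Ml gP0) //; ring.
  + move=> g a b p pR; rewrite !ffunE /=.
    (* After the shift by [p] the argument [a *m lX p *m invmx (lX (x *m p))] collapses to
       [a *m invmx (lX x)], and likewise for [b]. *)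
    rewrite -(@sum_coset_shift _ _ _ _ _ gR gP (fun x => extend0 PX alX (a *m lX p *m invmx (lX x))
        * extend0 P0 al0 (b *m l0 p *m invmx (l0 x)) * f (x *m g)) p) //.
      apply: eq_bigr => x /andP[xR _].
      have uXp := mxgroup_unit gGX (lXG pR); have uXx := mxgroup_unit gGX (lXG xR).
      have u0p := mxgroup_unit gG0 (l0G pR); have u0x := mxgroup_unit gG0 (l0G xR).
      rewrite lXM // l0M // !invmx_mul // !mulmxA.
      by rewrite -[a *m lX p *m _]mulmxA -[b *m l0 p *m _]mulmxA !mulmxV // !mulmx1.
    (* The factor [al r] coming from [f] cancels the inverses of [alX (lX r)] and [al0 (l0 r)]. *)
    move=> r x rP rR xR; have [rX r0 er] := compat rP rR.
    have uXx := mxgroup_unit gGX (lXG xR); have u0x := mxgroup_unit gG0 (l0G xR).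
    have uXr := mxgroup_unit gGX (lXG rR); have u0r := mxgroup_unit gG0 (l0G rR).
    rewrite lXM // l0M // !invmx_mul // !mulmxA -[r *m x *m g]mulmxA.
    rewrite (ext0_Mr gPX) ?(mxgroupV gPX) // (ext0_Mr gP0) ?(mxgroupV gP0) //.
    rewrite (mxcharV gPX) // (mxcharV gP0) // fP // er.
    have nX := mxchar_neq0 chX rX; have n0 := mxchar_neq0 ch0 r0.
    by field; apply/andP; split.
- move=> c f1 f2 _ _; apply/ffunP=> y; rewrite !ffunE mulr_sumr -big_split /=.
  by apply: eq_bigr => p _; rewrite !ffunE mulrDr mulrCA.
- move=> h f hG _; apply/ffunP=> y; rewrite !ffunE /=.
  by apply: eq_bigr => p _; rewrite !ffunE mulmxA.
Qed.

(** Since [ps_delta] is supported on [P], only the coset of 1 contributes, and there the characters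
    cancel by [compat]. *)
Lemma mackey_delta1 : mackey_op ps_delta (1%:M, 1%:M, 1%:M) = 1.
Proof.
rewrite ffunE /=; set x0 := coset_rep R P 1%:M.
have [x0R x0P] := coset_repP gR gP (mxgroup1 gR).
rewrite invmx1 mulmx1 in x0P.
rewrite (bigD1 x0) /=; last by rewrite x0R (coset_rep_id gR gP) ?(mxgroup1 gR) /=.
rewrite big1 ?addr0 => [|p /andP[/andP[pR /eqP rp] px]]; last first.
  rewrite ffunE mulmx1 [extend0 P al p]/extend0 ifF ?mulr0 //.
  apply: contraNF px => pP; rewrite -rp; apply/eqP.
  by apply: (coset_rep_eq gR gP); rewrite ?(mxgroup1 gR) // invmx1 mulmx1.
have [xX xO ex] := compat x0P x0R.
rewrite ffunE !mul1mx mulmx1 /extend0 (mxgroupV gPX) // (mxgroupV gP0) // x0P ex.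
rewrite (mxcharV gPX) // (mxcharV gP0) // mulrACA !mulVf ?mulr1 //.
  exact: (mxchar_neq0 ch0). 
exact: (mxchar_neq0 chX).
Qed.

(** By [lift], the value at [(g, a, b)] is the value at [(p *m g, 1, 1)] for any [p] in [R] with
    Levi components [a] and [b]. *)
Lemma ind_determined Phi Phi' c : inInd Phi -> inInd Phi' ->
  (forall g, g \in G -> Phi' (g, 1%:M, 1%:M) = c * Phi (g, 1%:M, 1%:M)) ->
  Phi' = [ffun y => c * Phi y].
Proof.
move=> [z1 [_ [_ l1]]] [z2 [_ [_ l2]]] H; apply/ffunP=> -[[g a] b]; rewrite ffunE.
have [/and3P[gG' aG bG]|nG] := boolP [&& g \in G, a \in GX & b \in G0]; last first.
  by rewrite z1 // z2 // mulr0.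
have [p pR [ep eq]] := lift aG bG.
have := H (p *m g); rewrite l1 // l2 // ep eq !mul1mx; apply.
by rewrite (mxgroupM gG) // sRG.
Qed.

Lemma ind_Ql T w q : intertw T -> q \in R -> lX q \in PX -> l0 q \in P0 ->
  T ps_delta (q *m w, 1%:M, 1%:M) = alX (lX q) * al0 (l0 q) * T ps_delta (w, 1%:M, 1%:M).
Proof.
move=> [Tin _] qR qX q0; have [_ [hX [h0 hR]]] := Tin _ ps_delta_in.
by rewrite hR // !mul1mx -{1}[lX q]mulmx1 -{1}[l0 q]mulmx1 hX // h0 // mulrA.
Qed.

(** Right translation by [p] multiplies [ps_delta] by [al p]. Together with [ind_Ql], this makes the
    values of [T ps_delta] at [(w, 1, 1)] equivariant under both groups of the double coset. *)
Lemma ind_Pr T w p : intertw T -> p \in P ->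
  T ps_delta (w *m p, 1%:M, 1%:M) = al p * T ps_delta (w, 1%:M, 1%:M).
Proof.
move=> [_ [Tlin Teq]] pP.
have z0 : inPS [ffun=> 0].
  by split=> [g _|p' g _]; rewrite !ffunE // mulr0.
(* Linearity is given only for [c * f1 + f2], so a pure multiple requires the value at 0, which
   comes from [c = -1] and [f1 = f2 = 0]. *)
have T0 : T [ffun=> 0] = [ffun=> 0].
  have := Tlin (-1) _ _ z0 z0.
  have -> : [ffun x => -1 * [ffun=> 0 : C] x + [ffun=> 0] x] = [ffun=> 0] :> {ffun 'M[E]_N -> C}.
    by apply/ffunP=> x; rewrite !ffunE mulr0 addr0.
  by move=> ->; apply/ffunP=> y; rewrite !ffunE mulN1r addNr.
have := Tlin (al p) _ _ ps_delta_in z0.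
have -> : [ffun x => al p * ps_delta x + [ffun=> 0] x] = [ffun x => ps_delta (x *m p)].
  by apply/ffunP=> x; rewrite !ffunE (ext0_Mr gP) // mulrC addr0.
rewrite Teq ?sPG //; last exact: ps_delta_in.
by move/ffunP/(_ (w, 1%:M, 1%:M)); rewrite !ffunE /= => ->; rewrite T0 ffunE addr0.
Qed.

(** The image of [ps_delta] is governed by its value at 1, because it vanishes off the double coset
    of 1. The expansion of [f] in translates of [ps_delta] then extends the proportionality to all
    of the principal series. *)
Lemma intertw_scalar T T' : intertw T -> T ps_delta (1%:M, 1%:M, 1%:M) = 1 -> intertw T' ->
  exists c : C, forall f, inPS f -> T' f = [ffun y => c * T f y].
Proof.
move=> iT T1 iT'; set c := T' ps_delta (1%:M, 1%:M, 1%:M); exists c.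
(* Evaluating at [q *m w], once through [q] on the left and once through its conjugate on the right,
   yields two different factors in front of the same value. *)
have vanish S w q : intertw S -> q \in R -> lX q \in PX -> l0 q \in P0 -> w \in G ->
    invmx w *m q *m w \in P -> al (invmx w *m q *m w) <> alX (lX q) * al0 (l0 q) ->
    S ps_delta (w, 1%:M, 1%:M) = 0.
  move=> iS qR qX q0 wG pP ne; have := ind_Ql w iS qR qX q0.
  have -> : q *m w = w *m (invmx w *m q *m w).
    by rewrite !mulmxA mulmxV ?mul1mx // (mxgroup_unit gG).
  rewrite ind_Pr // => /eqP; rewrite -subr_eq0 -mulrBl mulf_eq0 subr_eq0.
  by case/orP=> /eqP.
have Hd : T' ps_delta = [ffun y => c * T ps_delta y].
  apply: ind_determined => [||g gG'].
  - by case: iT => + _; apply; apply: ps_delta_in.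
  - by case: iT' => + _; apply; apply: ps_delta_in.
  have [q [qR qX q0 [qP|[pP ne]]]] := double_cosets gG'; last first.
    by rewrite !(vanish _ g q) // mulr0.
  have nq : alX (lX q) * al0 (l0 q) != 0.
    by rewrite mulf_neq0 ?(mxchar_neq0 chX) ?(mxchar_neq0 ch0).
  (* As [q *m g] lies in [P], its value is [al (q *m g)] times the value at 1, for [T] and [T']
     alike. *)
  apply: (mulfI nq); rewrite mulrCA -!ind_Ql // -[q *m g]mul1mx !ind_Pr // T1.
  by rewrite mulr1 mulrC.
case: (iT) => [Tin [Tlin Teq]]; case: (iT') => [T'in [T'lin T'eq]].
pose dl x : {ffun 'M[E]_N -> C} := [ffun g => ps_delta (g *m invmx x)].
have dlin x : x \in G -> inPS (dl x).
  by move=> xG; apply: inPS_shift; rewrite ?(mxgroupV gG) //; exact: ps_delta_in.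
have Hdl x : x \in G -> T' (dl x) = [ffun y => c * T (dl x) y].
  move=> xG; have vG := mxgroupV gG xG.
  rewrite /dl (T'eq _ _ vG ps_delta_in) (Teq _ _ vG ps_delta_in) Hd.
  by apply/ffunP=> y; rewrite !ffunE.
move=> f fin.
(* Partial sums of the expansion of [f], indexed by a list so that two-term linearity suffices in
   the induction. *)
pose fr r : {ffun 'M[E]_N -> C} :=
  [ffun g => \sum_(x <- r | (x \in G) && (coset_rep G P x == x)) f x * dl x g].
have key r : inPS (fr r) /\ T' (fr r) = [ffun y => c * T (fr r) y].
  elim: r => [|x r [IH1 IH2]].
    (* The empty sum is also written as a two-term combination, to which linearity applies. *)
    have -> : fr [::] = [ffun x => -1 * dl 1%:M x + dl 1%:M x].
      by apply/ffunP=> g; rewrite !ffunE big_nil mulN1r addNr.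
    have d1 := dlin _ (mxgroup1 gG).
    split; first exact: inPS_lin.
    rewrite Tlin // T'lin //; apply/ffunP=> y.
    by rewrite !ffunE !mulN1r !addNr mulr0.
  have [/andP[xG xr]|nx] := boolP ((x \in G) && (coset_rep G P x == x)); last first.
    suff -> : fr (x :: r) = fr r by [].
    by apply/ffunP=> g; rewrite !ffunE big_cons (negPf nx).
  have -> : fr (x :: r) = [ffun g => f x * dl x g + fr r g].
    by apply/ffunP=> g; rewrite !ffunE big_cons xG xr /= !ffunE.
  split; first by apply: inPS_lin => //; exact: dlin.
  rewrite Tlin // ?T'lin //; try exact: dlin.
  rewrite Hdl // IH2; apply/ffunP=> y; rewrite !ffunE.
  by rewrite mulrDr mulrCA.
suff -> : f = fr (index_enum _) by case: (key (index_enum _)).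
apply/ffunP=> g; rewrite ffunE; case: fin => f0 fP.
have [gG'|gnG] := boolP (g \in G); last first.
  rewrite f0 // big1 // => x /andP[xG _].
  by case: (dlin x xG) => -> //; rewrite mulr0.
have [x0G x0P] := coset_repP gG gP gG'; set x0 := coset_rep G P g in x0G x0P.
have ug := mxgroup_unit gG gG'; have ux0 := mxgroup_unit gG x0G.
(* At [g] only the representative [x0] of its own coset contributes, with value
   [f x0 * al (g *m invmx x0)], which is [f g]. *)
rewrite (bigD1 x0) /=; last by rewrite x0G (coset_rep_id gG gP) ?eqxx.
rewrite big1 ?addr0 => [|x /andP[/andP[xG /eqP rx] nx]]; last first.
  rewrite !ffunE /extend0 ifF ?mulr0 //; apply: contraNF nx => gxP.
  by rewrite -rx eq_sym; apply/eqP; apply: (coset_rep_eq gG gP).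
have gx : g *m invmx x0 \in P.
  by rewrite -[g *m _]invmxK (mxgroupV gP) // invmx_mul ?unitmx_inv // invmxK.
rewrite !ffunE /extend0 gx mulrC -fP // mulmxKV //.
Qed.

Lemma mackey_one_dim : exists T, [/\ intertw T, (exists2 f, inPS f & T f != 0) &
  forall T', intertw T' -> exists c : C, forall f, inPS f -> T' f = [ffun y => c * T f y]].
Proof.
exists mackey_op; split; first exact: mackey_intertw.
  exists ps_delta; first exact: ps_delta_in.
  apply/eqP=> /ffunP/(_ (1%:M, 1%:M, 1%:M)); rewrite mackey_delta1 ffunE.
  by move/eqP; rewrite oner_eq0.
by move=> T'; apply: intertw_scalar; [exact: mackey_intertw | exact: mackey_delta1].
Qed.
End Mackey.

(** * Linear algebra *)

Section LinearAlgebra.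
Variable F : fieldType.

(** Sylvester's identity: the block matrix with blocks 1, [- A], [B], 1 factors in two ways. *)
Lemma det_add1C m n (A : 'M[F]_(m, n)) (B : 'M[F]_(n, m)) :
  \det (1%:M + A *m B) = \det (1%:M + B *m A).
Proof.
have e1 : block_mx 1%:M 0 B 1%:M *m block_mx 1%:M (- A) 0 (1%:M + B *m A)
          = block_mx 1%:M (- A) B 1%:M.
  rewrite mulmx_block !mul1mx !mulmx1 ?mul0mx ?mulmx0 !addr0 mulmxN.
  by rewrite [1%:M + _]addrC addrA addNr add0r.
have e2 : block_mx (1%:M + A *m B) (- A) 0 1%:M *m block_mx 1%:M 0 B 1%:M
          = block_mx 1%:M (- A) B 1%:M.
  by rewrite mulmx_block !mul1mx !mulmx1 ?mul0mx ?mulmx0 !add0r mulNmx addrK.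
have := congr1 determinant e2; rewrite -e1 !det_mulmx !det_ublock !det_lblock !det1.
by rewrite !mulr1 !mul1r.
Qed.

(** Two sizes are allowed in order to cover base changes between dimensions that are equal but
    written differently. *)
Lemma det_conj m n (A : 'M[F]_(m, n)) (B : 'M[F]_(n, m)) (M : 'M[F]_n) :
  A *m B = 1%:M -> B *m A = 1%:M -> \det (A *m M *m B) = \det M.
Proof.
move=> AB BA.
have -> : A *m M *m B = 1%:M + A *m ((M - 1%:M) *m B).
  by rewrite mulmxBl mul1mx mulmxBr AB mulmxA addrC subrK.
by rewrite det_add1C -mulmxA BA mulmx1 addrC subrK.
Qed.

Lemma det_dim0 n (M : 'M[F]_n) : n = 0%N -> \det M = 1.
Proof. by move=> n0; move: M; rewrite n0 => M; rewrite det_mx00. Qed.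

(** The functional is a rescaled column of the cokernel matrix on which [x] does not vanish. *)
Lemma separating_functional d n (U : 'M[F]_(d, n)) (x : 'rV[F]_n) :
  ~~ (x <= U)%MS -> exists u : 'cV[F]_n, U *m u = 0 /\ x *m u = 1%:M.
Proof.
rewrite submxE; move: (cokermx U) (mulmx_coker U) => K UK nz.
have [j nzj] : exists j, (x *m K) 0 j != 0.
  apply/existsP; apply: contraR nz; rewrite negb_exists => /forallP h.
  by apply/eqP/rowP=> j; rewrite [RHS]mxE; apply/eqP; move: (h j); rewrite negbK.
exists (((x *m K) 0 j)^-1 *: (K *m delta_mx j 0)).
rewrite -!scalemxAr !mulmxA UK mul0mx scaler0 -colE; split=> //.
apply/rowP=> i; rewrite !ord1 [LHS]mxE [col _ _ _ _]mxE [RHS]mxE eqxx mulr1n.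
by rewrite mulVf.
Qed.

(** With [x = a *m U], the map acts on [U] by the rank-one perturbation [1 + (U *m u) *m a], whose
    determinant is given by [det_add1C]. *)
Lemma stab_rank1 d n (U : 'M[F]_(d, n)) (x y : 'rV[F]_n) (u v : 'cV[F]_n) :
  U *m v = 0 -> (x <= U)%MS ->
  exists2 r : 'M[F]_d, U *m (1%:M + u *m x + v *m y) = r *m U
                     & \det r = 1 + (x *m u) 0 0.
Proof.
move=> Uv /submxP[a xE]; exists (1%:M + U *m u *m a).
  by rewrite !mulmxDr !mulmxA Uv mul0mx addr0 mulmx1 mulmxDl mul1mx -[_ *m a *m U]mulmxA -xE.
by rewrite det_add1C mulmxA -xE det_mx11 !mxE eqxx.
Qed.

Lemma stab_trivial d n (U : 'M[F]_(d, n)) (x y : 'rV[F]_n) (u v : 'cV[F]_n) :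
  U *m u = 0 -> U *m v = 0 -> U *m (1%:M + u *m x + v *m y) = 1%:M *m U.
Proof.
by move=> Uu Uv; rewrite !mulmxDr !mulmxA Uu Uv !mul0mx !addr0 mulmx1 mul1mx.
Qed.

Lemma stab_span d n (U : 'M[F]_(d, n)) (x y : 'rV[F]_n) (u v : 'cV[F]_n) :
  (x <= U)%MS -> (y <= U)%MS -> (U *m (1%:M + u *m x + v *m y) <= U)%MS.
Proof.
move=> xU yU; rewrite !mulmxDr mulmx1 !mulmxA.
by rewrite !addmx_sub ?submx_refl // mulmx_sub.
Qed.

Lemma submx_mul0 d e n p q (x : 'M[F]_(d, n)) (U : 'M[F]_(e, n)) (A : 'M[F]_(n, p))
    (B : 'M[F]_(p, q)) : (x <= U)%MS -> U *m A *m B = 0 -> x *m A *m B = 0.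
Proof. by case/submxP=> v -> UAB; rewrite -!mulmxA [U *m _]mulmxA UAB mulmx0. Qed.

Lemma sub_col_mxl d e n (A : 'M[F]_(d, n)) (B : 'M[F]_(e, n)) : (A <= col_mx A B)%MS.
Proof. by have := submx_refl (col_mx A B); rewrite {1}col_mx_sub => /andP[]. Qed.
Lemma sub_col_mxr d e n (A : 'M[F]_(d, n)) (B : 'M[F]_(e, n)) : (B <= col_mx A B)%MS.
Proof. by have := submx_refl (col_mx A B); rewrite {1}col_mx_sub => /andP[]. Qed.

End LinearAlgebra.

(** * Isometry groups and Siegel subgroups *)

Section Adjoint.
Variables (E : finFieldType) (s : {rmorphism E -> E}).
Hypothesis hs : forall x : E, s (s x) = x.

Definition adjmx m n (A : 'M[E]_(m, n)) : 'M[E]_(n, m) := (map_mx s A)^T.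

Lemma adjmxM m n p (A : 'M[E]_(m, n)) (B : 'M[E]_(n, p)) :
  adjmx (A *m B) = adjmx B *m adjmx A.
Proof. by rewrite /adjmx map_mxM trmx_mul. Qed.
Lemma adjmxD m n (A B : 'M[E]_(m, n)) : adjmx (A + B) = adjmx A + adjmx B.
Proof. by rewrite /adjmx map_mxD linearD. Qed.
Lemma adjmxN m n (A : 'M[E]_(m, n)) : adjmx (- A) = - adjmx A.
Proof. by rewrite /adjmx map_mxN linearN. Qed.
Lemma adjmxZ m n a (A : 'M[E]_(m, n)) : adjmx (a *: A) = s a *: adjmx A.
Proof. by rewrite /adjmx map_mxZ linearZ. Qed.
Lemma adjmx1 n : adjmx (1%:M : 'M[E]_n) = 1%:M.
Proof. by rewrite /adjmx map_mx1 trmx1. Qed.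
Lemma adjmx0 m n : adjmx (0 : 'M[E]_(m, n)) = 0.
Proof. by rewrite /adjmx map_mx0 trmx0. Qed.
Lemma adjmxK m n (A : 'M[E]_(m, n)) : adjmx (adjmx A) = A.
Proof. by apply/matrixP=> i j; rewrite !mxE hs. Qed.
Lemma adjmx_block m1 m2 n1 n2 (A : 'M[E]_(m1, n1)) (B : 'M[E]_(m1, n2))
    (C : 'M[E]_(m2, n1)) (D : 'M[E]_(m2, n2)) :
  adjmx (block_mx A B C D) = block_mx (adjmx A) (adjmx C) (adjmx B) (adjmx D).
Proof. by rewrite /adjmx map_block_mx tr_block_mx. Qed.
Lemma det_adjmx n (A : 'M[E]_n) : \det (adjmx A) = s (\det A).
Proof. by rewrite /adjmx det_tr det_map_mx. Qed.

Lemma isom_grpE n (K g : 'M[E]_n) :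
  (g \in isom_grp s K) = (g \in unitmx) && (g *m K *m adjmx g == K).
Proof. by rewrite inE. Qed.

Lemma isom_grpP n (K g : 'M[E]_n) : g \in isom_grp s K -> g *m K *m adjmx g = K.
Proof. by rewrite isom_grpE => /andP[_ /eqP]. Qed.

Lemma isom_grp_unit n (K g : 'M[E]_n) : g \in isom_grp s K -> g \in unitmx.
Proof. by rewrite isom_grpE => /andP[]. Qed.

Lemma isom_mxgroup n (K : 'M[E]_n) : mxgroup (isom_grp s K).
Proof.
split=> [|x y|x|x].
- by rewrite isom_grpE unitmx1 adjmx1 mulmx1 mul1mx eqxx.
- rewrite !isom_grpE => /andP[ux /eqP ex] /andP[uy /eqP ey].
  by rewrite unitmx_mul ux uy adjmxM -{2}ex -{2}ey !mulmxA eqxx.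
- exact: isom_grp_unit.
- rewrite !isom_grpE => /andP[ux /eqP ex]; rewrite unitmx_inv ux /=.
  rewrite -{1}ex !mulmxA mulVmx // mul1mx -mulmxA -adjmxM mulVmx // adjmx1.
  by rewrite mulmx1.
Qed.

Lemma stab_inv d n (U : 'M[E]_(d, n)) p :
  p \in unitmx -> (U *m p <= U)%MS -> (U *m invmx p <= U)%MS.
Proof.
move=> up Up; have fp : row_free p by rewrite row_free_unit.
(* As [p] is invertible, [U *m p] has the rank of [U], so the inclusion is an equality. *)
have /eqmxP e : (U *m p == U)%MS.
  by have := mxrank_leqif_eq Up; rewrite mxrankMfree // => /leqif_refl.
by rewrite -(submxMfree _ _ fp) mulmxKV // e.
Qed.

Lemma stab_mxgroup d n (H : {set 'M[E]_n}) (U : 'M[E]_(d, n)) : mxgroup H ->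
  mxgroup [set p in H | (U *m p <= U)%MS].
Proof.
move=> gH; split=> [|x y|x|x].
- by rewrite inE (mxgroup1 gH) mulmx1 submx_refl.
- rewrite !inE => /andP[xH Ux] /andP[yH Uy]; rewrite (mxgroupM gH) //=.
  by rewrite mulmxA (submx_trans _ Uy) // submxMr.
- by rewrite inE => /andP[xH _]; exact: (mxgroup_unit gH).
- rewrite !inE => /andP[xH Ux]; rewrite (mxgroupV gH) // stab_inv //.
  exact: (mxgroup_unit gH).
Qed.

Lemma siegel_mxgroup n (J : 'M[E]_n) : mxgroup (siegel s J).
Proof. exact/stab_mxgroup/isom_mxgroup. Qed.

Lemma parX_mxgroup k m ky (J : 'M[E]_(k + m + ky)) : mxgroup (parX s J).
Proof.
have -> : parX s J = [set p in [set p in isom_grp s (dbl_form J) |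
    (eXd k m ky *m p <= eXd k m ky)%MS] |
    (col_mx (eXd k m ky) (eV0d k m ky) *m p <= col_mx (eXd k m ky) (eV0d k m ky))%MS].
  by apply/setP=> p; rewrite !inE andbA.
by apply/stab_mxgroup/stab_mxgroup/isom_mxgroup.
Qed.

(** * Characters of the Siegel subgroups *)

Section Character.
Variables (C : fieldType) (chi : E -> C).
Hypotheses (chi0 : forall x : E, x != 0 -> chi x != 0)
  (chiM : forall x y : E, x != 0 -> y != 0 -> chi (x * y) = chi x * chi y).

Lemma chi1 : chi 1 = 1.
Proof.
have n1 := chi0 (oner_neq0 E); apply: (mulfI n1).
by rewrite -chiM ?oner_neq0 // !mulr1.
Qed.

Lemma chiV x : x != 0 -> chi x^-1 = (chi x)^-1.
Proof.
move=> nx; apply: (mulfI (chi0 nx)).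
by rewrite mulfV ?chi0 // -chiM ?invr_eq0 // mulfV // chi1.
Qed.

Definition diag_action n (p : 'M[E]_(n + n)) : 'M[E]_n := lsubmx (diagmx n *m p).

Lemma diag_actionE n (p : 'M[E]_(n + n)) :
  (diagmx n *m p <= diagmx n)%MS -> diagmx n *m p = diag_action p *m diagmx n.
Proof.
case/submxP=> r er; rewrite /diag_action er; congr (_ *m _).
by rewrite /diagmx mul_mx_row mulmx1 row_mxKl.
Qed.

Lemma diag_action_eq n (p : 'M[E]_(n + n)) r :
  diagmx n *m p = r *m diagmx n -> diag_action p = r.
Proof. by move=> er; rewrite /diag_action er /diagmx mul_mx_row mulmx1 row_mxKl. Qed.

Lemma siegelP n (J : 'M[E]_n) p : p \in siegel s J ->
  diagmx n *m p = diag_action p *m diagmx n.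
Proof. by rewrite inE => /andP[_]; exact: diag_actionE. Qed.

Lemma diag_actionM n (J : 'M[E]_n) p p' : p \in siegel s J -> p' \in siegel s J ->
  diag_action (p *m p') = diag_action p *m diag_action p'.
Proof.
move=> /siegelP ep /siegelP ep'; apply: diag_action_eq.
by rewrite mulmxA ep -mulmxA ep' mulmxA.
Qed.

Lemma diag_action1 n : diag_action (1%:M : 'M[E]_(n + n)) = 1%:M.
Proof. by apply: diag_action_eq; rewrite mulmx1 mul1mx. Qed.

Lemma diag_action_det n (J : 'M[E]_n) p : p \in siegel s J ->
  \det (diag_action p) != 0.
Proof.
move=> pP; have gP := siegel_mxgroup J.
have := congr1 determinant (diag_actionM pP (mxgroupV gP pP)).
rewrite mulmxV ?(mxgroup_unit gP) // diag_action1 det1 det_mulmx => e.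
by apply: contraTneq (oner_neq0 E) => d0; rewrite e d0 mul0r eqxx.
Qed.

Lemma ps_factorE n z (p : 'M[E]_(n + n)) : ps_factor s chi z p =
  chi (\det (diag_action p)) *
  (if z then (chi (s (\det p / \det (diag_action p))))^-1 else 1).
Proof. by rewrite /ps_factor; case: z; rewrite ?mulr1. Qed.

(** In dimension 0 the Gram matrix equals 0 even for a nondegenerate form, so the test [J0 == 0]
    selects the zero-form character; both characters are trivial there. *)
Lemma ps_factor_dim0 n z (p : 'M[E]_(n + n)) : n = 0%N -> ps_factor s chi z p = 1.
Proof.
by move=> n0; rewrite ps_factorE !det_dim0 ?n0 // divr1 rmorph1 chi1 invr1; case: z; rewrite mulr1.
Qed.

Lemma siegel_mxchar n (J : 'M[E]_n) z : mxchar (siegel s J) (ps_factor s chi z).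
Proof.
have gP := siegel_mxgroup J.
have nz p : p \in siegel s J -> s (\det p / \det (diag_action p)) != 0.
  move=> pP; rewrite fmorph_eq0 mulf_neq0 ?invr_eq0 ?(diag_action_det pP) //.
  by have := mxgroup_unit gP pP; rewrite unitmxE unitfE.
split=> [p p' pP pP'|p pP]; rewrite !ps_factorE; last first.
  rewrite mulf_neq0 ?chi0 ?(diag_action_det pP) //.
  by case: z; rewrite ?oner_neq0 ?invr_eq0 ?chi0 ?nz.
rewrite (diag_actionM pP pP') !det_mulmx chiM ?(diag_action_det pP) ?(diag_action_det pP') //.
case: z; last by rewrite !mulr1.
by rewrite -mulf_div rmorphM chiM ?nz // invfM mulrACA.
Qed.

End Character.
End Adjoint.

(** * The doubled space *)

Section Coordinates.
Variable E : fieldType.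

Definition antidiag n : 'M[E]_(n, n + n) := row_mx 1%:M (- 1%:M).

Definition dblmx d n (a : 'M[E]_(d, n)) : 'M[E]_(d + d, n + n) := block_mx a 0 0 a.

Lemma dblmxM d n p (a : 'M[E]_(d, n)) (b : 'M[E]_(n, p)) :
  dblmx a *m dblmx b = dblmx (a *m b).
Proof. by rewrite /dblmx mulmx_block ?mulmx0 ?mul0mx ?addr0 ?add0r. Qed.
Lemma dblmx_tr d n (a : 'M[E]_(d, n)) : (dblmx a)^T = dblmx a^T.
Proof. by rewrite /dblmx tr_block_mx !trmx0. Qed.
Lemma dblmx1 n : dblmx (1%:M : 'M[E]_n) = 1%:M.
Proof. by rewrite /dblmx -scalar_mx_block. Qed.
Lemma dblmx0 d n : dblmx (0 : 'M[E]_(d, n)) = 0.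
Proof. by rewrite /dblmx block_mx0. Qed.
Lemma dblmxD d n (a b : 'M[E]_(d, n)) : dblmx (a + b) = dblmx a + dblmx b.
Proof. by rewrite /dblmx add_block_mx ?addr0. Qed.

Lemma diag_dbl d n (a : 'M[E]_(d, n)) : diagmx d *m dblmx a = a *m diagmx n.
Proof. by rewrite mul_row_block mul_mx_row ?mul1mx ?mulmx0 ?mulmx1 ?addr0 ?add0r. Qed.
Lemma antidiag_dbl d n (a : 'M[E]_(d, n)) : antidiag d *m dblmx a = a *m antidiag n.
Proof.
by rewrite mul_row_block mul_mx_row ?mulmx0 ?mulmxN ?mulmx1 ?addr0 ?add0r ?mul1mx ?mulNmx ?mul1mx.
Qed.

Lemma diag_diagT n : diagmx n *m (diagmx n)^T = 2 *: 1%:M :> 'M[E]_n.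
Proof. by rewrite tr_row_mx mul_row_col !trmx1 ?mulmx1 scaler_nat. Qed.
Lemma diag_antidiagT n : diagmx n *m (antidiag n)^T = 0.
Proof. by rewrite tr_row_mx mul_row_col linearN /= !trmx1 ?mulmxN ?mulmx1 subrr. Qed.
Lemma antidiag_diagT n : antidiag n *m (diagmx n)^T = 0.
Proof. by rewrite tr_row_mx mul_row_col !trmx1 ?mulNmx ?mulmx1 subrr. Qed.
Lemma antidiag_antidiagT n : antidiag n *m (antidiag n)^T = 2 *: 1%:M.
Proof.
by rewrite tr_row_mx mul_row_col linearN /= !trmx1 ?mulmxN ?mulNmx ?opprK ?mulmx1 scaler_nat.
Qed.
(** Up to the factor 2, these are the projections onto [V^Delta] and [V^nabla]. *)
Lemma diagT_add n : (diagmx n)^T *m diagmx n + (antidiag n)^T *m antidiag n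
  = 2 *: 1%:M :> 'M[E]_(n + n).
Proof.
rewrite !tr_row_mx !mul_col_row !linearN /= !trmx1 ?mulmx1 ?mulNmx ?mulmxN ?mulmx1 ?opprK.
by rewrite add_block_mx !subrr -!mulr2n scalar_mx_block scale_block_mx !scaler0 !scaler_nat.
Qed.

Lemma dbl_diagT d n (a : 'M[E]_(d, n)) :
  dblmx a *m (diagmx n)^T = (diagmx d)^T *m a.
Proof. by apply: trmx_inj; rewrite !trmx_mul !trmxK dblmx_tr diag_dbl. Qed.
Lemma dbl_antidiagT d n (a : 'M[E]_(d, n)) :
  dblmx a *m (antidiag n)^T = (antidiag d)^T *m a.
Proof. by apply: trmx_inj; rewrite !trmx_mul !trmxK dblmx_tr antidiag_dbl. Qed.
Lemma diag_dblT d n (a : 'M[E]_(d, n)) :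
  diagmx n *m (dblmx a)^T = a^T *m diagmx d.
Proof. by rewrite dblmx_tr diag_dbl. Qed.
Lemma antidiag_dblT d n (a : 'M[E]_(d, n)) :
  antidiag n *m (dblmx a)^T = a^T *m antidiag d.
Proof. by rewrite dblmx_tr antidiag_dbl. Qed.

(** The doubled form exchanges [V^Delta] and [V^nabla] up to [J], which makes both of them totally
    isotropic. *)
Lemma diag_form n (J : 'M[E]_n) : diagmx n *m dbl_form J = J *m antidiag n.
Proof.
by rewrite mul_row_block mul_mx_row ?mul1mx ?mulmx0 ?mulmxN ?mulmx1 ?addr0 ?add0r.
Qed.
Lemma antidiag_form n (J : 'M[E]_n) : antidiag n *m dbl_form J = J *m diagmx n.
Proof.
rewrite mul_row_block mul_mx_row ?mulmx0 ?addr0 ?add0r ?mul1mx ?mulmxN ?mulNmx ?opprK ?mul1mx.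
by rewrite ?mulmx1.
Qed.
Lemma form_diagT n (J : 'M[E]_n) : dbl_form J *m (diagmx n)^T = (antidiag n)^T *m J.
Proof.
rewrite /dbl_form !tr_row_mx mul_block_col mul_col_mx !linearN /= !trmx1.
by rewrite ?mul0mx ?mulmx1 ?addr0 ?add0r ?mulNmx ?mul1mx.
Qed.
Lemma form_antidiagT n (J : 'M[E]_n) : dbl_form J *m (antidiag n)^T = (diagmx n)^T *m J.
Proof.
rewrite /dbl_form !tr_row_mx mul_block_col mul_col_mx !linearN /= !trmx1.
by rewrite ?mul0mx ?mulmxN ?mulNmx ?mulmx1 ?addr0 ?add0r ?mul1mx ?opprK ?subr0.
Qed.
Lemma dbl_form_dblT d e n (a : 'M[E]_(d, n)) (b : 'M[E]_(e, n)) (J : 'M[E]_n) :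
  dblmx a *m dbl_form J *m (dblmx b)^T
  = block_mx (a *m J *m b^T) 0 0 (- (a *m J *m b^T)).
Proof.
rewrite dblmx_tr /dblmx /dbl_form !mulmx_block ?mul0mx ?mulmx0 ?addr0 ?add0r.
by rewrite ?mulmx0 ?mul0mx ?addr0 ?add0r ?mulmxN ?mulNmx.
Qed.

(** * Coordinate inclusions of [X], [V_0] and [Y] *)

Section Selection.
Variables (k m ky : nat).
Notation n := (k + m + ky)%N.
Notation a := (@eXv E k m ky).
Notation b := (@eV0v E k m ky).
Notation c := (@eYv E k m ky).

Lemma eXdE : eXd k m ky = dblmx a.
Proof.
apply/matrixP=> i j; rewrite /eXd /dblmx /sel /eXv !mxE.
case: (splitP i) => i' ei; rewrite !mxE; case: (splitP j) => j' ej; rewrite !mxE /dpos ei ej.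
- by rewrite ltn_ord add0n.
- rewrite ltn_ord add0n; case: eqP => // e; exfalso; have := ltn_ord i'; lia.
- rewrite ltnNge leq_addr /=; case: eqP => // e; exfalso; have := ltn_ord j'; lia.
- by rewrite ltnNge leq_addr /= addn0 addKn eqn_add2l.
Qed.

Lemma eV0dE : eV0d k m ky = dblmx b.
Proof.
apply/matrixP=> i j; rewrite /eV0d /dblmx /sel /eV0v !mxE.
case: (splitP i) => i' ei; rewrite !mxE; case: (splitP j) => j' ej; rewrite !mxE /dpos ei ej.
- by rewrite ltn_ord.
- rewrite ltn_ord; case: eqP => // e; exfalso; have := ltn_ord i'; lia.
- rewrite ltnNge leq_addr /=; case: eqP => // e; exfalso; have := ltn_ord j'; lia.
- by rewrite ltnNge leq_addr /= addKn -[(_ + k + i')%N]addnA eqn_add2l.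
Qed.

Lemma col_abc : col_mx (col_mx a b) c = 1%:M.
Proof.
apply/matrixP=> i j; rewrite !mxE.
case: (splitP i) => i' ei; rewrite !mxE ?(inj_eq val_inj).
  case: (splitP i') => i'' ei'; rewrite !mxE; congr (nat_of_bool _)%:R.
    by rewrite -val_eqE /= ei ei' eq_sym.
  by rewrite -val_eqE /= ei ei' eq_sym.
by rewrite -val_eqE /= ei eq_sym.
Qed.

Lemma abcT : col_mx (col_mx a b) c *m (col_mx (col_mx a b) c)^T = 1%:M.
Proof. by rewrite col_abc trmx1 mulmx1. Qed.

Lemma abc_rel :
  [/\ [/\ a *m a^T = 1%:M, a *m b^T = 0 & a *m c^T = 0],
      [/\ b *m a^T = 0, b *m b^T = 1%:M & b *m c^T = 0],
      [/\ c *m a^T = 0, c *m b^T = 0 & c *m c^T = 1%:M] &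
      a^T *m a + b^T *m b + c^T *m c = 1%:M].
Proof.
have H := abcT; have := mulmx1C H; move: a b c H => A B D H.
rewrite !tr_col_mx !mul_row_col => sum1.
move: H; rewrite tr_col_mx mul_col_row (scalar_mx_block (k + m) ky) => /eq_block_mx[].
rewrite tr_col_mx mul_col_row (scalar_mx_block k m) => /eq_block_mx[-> -> -> ->].
rewrite mul_col_mx -col_mx0 => /eq_col_mx[-> ->].
rewrite mul_mx_row -row_mx0 => /eq_row_mx[-> ->] ->.
by split=> //; rewrite sum1 col_mx0 row_mx0 -!scalar_mx_block.
Qed.
End Selection.

End Coordinates.

Section AdjointReal.
Variables (E : finFieldType) (s : {rmorphism E -> E}).

Lemma adjmx_sel d N f : adjmx s (sel d N f) = (sel d N f)^T.
Proof. by apply/matrixP=> i j; rewrite !mxE rmorph_nat. Qed.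
Lemma adjmx_dbl d n (a : 'M[E]_(d, n)) : adjmx s (dblmx a) = dblmx (adjmx s a).
Proof. by rewrite /dblmx adjmx_block !adjmx0. Qed.
Lemma adjmx_diag n : adjmx s (diagmx n) = (diagmx n)^T.
Proof. by rewrite /adjmx map_row_mx !map_mx1. Qed.
Lemma adjmx_antidiag n : adjmx s (antidiag E n) = (antidiag E n)^T.
Proof. by rewrite /adjmx map_row_mx map_mxN !map_mx1. Qed.
End AdjointReal.

(** * The parabolic subgroup and its orbits on Lagrangians *)

Section Parabolic.
Variables (E : finFieldType) (s : {rmorphism E -> E}).
Hypothesis hs : forall x : E, s (s x) = x.
Hypothesis two_neq0 : (2 : E) != 0.
Variables (k m ky : nat).
Notation n := (k + m + ky)%N.
Notation a := (@eXv E k m ky).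
Notation b := (@eV0v E k m ky).
Notation c := (@eYv E k m ky).
Variable J : 'M[E]_n.
Hypotheses (Jaa : a *m J *m a^T = 0) (Jab : a *m J *m b^T = 0) (Jba : b *m J *m a^T = 0).
Hypotheses (Jcc : c *m J *m c^T = 0) (Jcb : c *m J *m b^T = 0) (Jbc : b *m J *m c^T = 0).
Variable eps : E.
Hypotheses (eps2 : eps * eps = 1) (seps : s eps = eps).
Hypothesis Jsym : J = eps *: adjmx s J.
Hypothesis degen : (J = 0 /\ ky = 0%N) \/ J \in unitmx.

Local Notation S := (dblmx a).
Local Notation S0 := (dblmx b).
Local Notation SY := (dblmx c).
Local Notation V := (diagmx n).
Local Notation Z := (antidiag E n).
Local Notation K := (dbl_form J).
Local Notation J0 := (formV0 J).
Local Notation levX := (@levX E k m ky).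
Local Notation lev0 := (@lev0 E k m ky).
Local Notation G := (isom_grp s K).
Local Notation R := (parX s J).

Let aa : a *m a^T = 1%:M. Proof. by case: (abc_rel E k m ky) => [[]]. Qed.
Let ab : a *m b^T = 0. Proof. by case: (abc_rel E k m ky) => [[]]. Qed.
Let ac : a *m c^T = 0. Proof. by case: (abc_rel E k m ky) => [[]]. Qed.
Let ba : b *m a^T = 0. Proof. by case: (abc_rel E k m ky) => _ []. Qed.
Let bb : b *m b^T = 1%:M. Proof. by case: (abc_rel E k m ky) => _ []. Qed.
Let bc : b *m c^T = 0. Proof. by case: (abc_rel E k m ky) => _ []. Qed.
Let ca : c *m a^T = 0. Proof. by case: (abc_rel E k m ky) => _ _ []. Qed.
Let cb : c *m b^T = 0. Proof. by case: (abc_rel E k m ky) => _ _ []. Qed.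
Let cc : c *m c^T = 1%:M. Proof. by case: (abc_rel E k m ky) => _ _ []. Qed.
Let abc1 : a^T *m a + b^T *m b + c^T *m c = 1%:M.
Proof. by case: (abc_rel E k m ky). Qed.

Lemma expand_abc p (x : 'M[E]_(p, n)) :
  x = x *m a^T *m a + x *m b^T *m b + x *m c^T *m c.
Proof. by rewrite -!mulmxA -!mulmxDr abc1 mulmx1. Qed.

Let SS : S *m S^T = 1%:M. Proof. by rewrite dblmx_tr dblmxM aa dblmx1. Qed.
Let SS0 : S *m S0^T = 0. Proof. by rewrite dblmx_tr dblmxM ab dblmx0. Qed.
Let SSY : S *m SY^T = 0. Proof. by rewrite dblmx_tr dblmxM ac dblmx0. Qed.
Let S0S : S0 *m S^T = 0. Proof. by rewrite dblmx_tr dblmxM ba dblmx0. Qed.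
Let S0S0 : S0 *m S0^T = 1%:M. Proof. by rewrite dblmx_tr dblmxM bb dblmx1. Qed.
Let S0SY : S0 *m SY^T = 0. Proof. by rewrite dblmx_tr dblmxM bc dblmx0. Qed.
Let SYS : SY *m S^T = 0. Proof. by rewrite dblmx_tr dblmxM ca dblmx0. Qed.
Let SYS0 : SY *m S0^T = 0. Proof. by rewrite dblmx_tr dblmxM cb dblmx0. Qed.
Let SYSY : SY *m SY^T = 1%:M. Proof. by rewrite dblmx_tr dblmxM cc dblmx1. Qed.
Let Ssum : S^T *m S + S0^T *m S0 + SY^T *m SY = 1%:M.
Proof. by rewrite !dblmx_tr !dblmxM -!dblmxD abc1 dblmx1. Qed.

Let SKS : S *m K *m S^T = 0. Proof. by rewrite dbl_form_dblT Jaa oppr0 block_mx0. Qed.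
Let SKS0 : S *m K *m S0^T = 0. Proof. by rewrite dbl_form_dblT Jab oppr0 block_mx0. Qed.
Let S0KS : S0 *m K *m S^T = 0. Proof. by rewrite dbl_form_dblT Jba oppr0 block_mx0. Qed.
Let S0KS0 : S0 *m K *m S0^T = dbl_form J0. Proof. by rewrite dbl_form_dblT. Qed.
Let SYKSY : SY *m K *m SY^T = 0. Proof. by rewrite dbl_form_dblT Jcc oppr0 block_mx0. Qed.
Let SYKS0 : SY *m K *m S0^T = 0. Proof. by rewrite dbl_form_dblT Jcb oppr0 block_mx0. Qed.
Let S0KSY : S0 *m K *m SY^T = 0. Proof. by rewrite dbl_form_dblT Jbc oppr0 block_mx0. Qed.

Let SKV : S *m K *m V^T = (antidiag E k)^T *m a *m J.
Proof. by rewrite -mulmxA form_diagT mulmxA dbl_antidiagT. Qed.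
Let VKS : V *m K *m S^T = J *m a^T *m antidiag E k.
Proof. by rewrite diag_form -mulmxA antidiag_dblT mulmxA. Qed.
Let VKV : V *m K *m V^T = 0.
Proof. by rewrite diag_form -mulmxA antidiag_diagT mulmx0. Qed.
Let ZKV : Z *m K *m V^T = 2 *: J.
Proof. by rewrite antidiag_form -mulmxA diag_diagT -scalemxAr mulmx1. Qed.
Let VKZ : V *m K *m Z^T = 2 *: J.
Proof. by rewrite diag_form -mulmxA antidiag_antidiagT -scalemxAr mulmx1. Qed.
Let ZKZ : Z *m K *m Z^T = 0.
Proof. by rewrite antidiag_form -mulmxA diag_antidiagT mulmx0. Qed.

Let bVS0 : b *m V *m S0^T = diagmx m.
Proof. by rewrite -mulmxA diag_dblT mulmxA bb mul1mx. Qed.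
Let bVS : b *m V *m S^T = 0.
Proof. by rewrite -mulmxA diag_dblT mulmxA ba mul0mx. Qed.

Let adja : adjmx s a = a^T. Proof. exact: adjmx_sel. Qed.
Let adjb : adjmx s b = b^T. Proof. exact: adjmx_sel. Qed.
Let adjcT : adjmx s c^T = c. Proof. by rewrite -(adjmx_sel s) adjmxK. Qed.
Let adjVT : adjmx s V^T = V. Proof. by rewrite -(adjmx_diag s) adjmxK. Qed.
Let adjS : adjmx s S = S^T. Proof. by rewrite adjmx_dbl adjmx_sel dblmx_tr. Qed.
Let adjS0 : adjmx s S0 = S0^T. Proof. by rewrite adjmx_dbl adjmx_sel dblmx_tr. Qed.
Let adjSY : adjmx s SY = SY^T. Proof. by rewrite adjmx_dbl adjmx_sel dblmx_tr. Qed.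

Let Ksym : K = eps *: adjmx s K.
Proof.
by rewrite /dbl_form adjmx_block adjmxN !adjmx0 scale_block_mx !scaler0 scalerN -Jsym.
Qed.

(** * Levi components of the parabolic subgroup *)

Lemma parXE p : (p \in R) = [&& p \in G, (S *m p <= S)%MS
  & (col_mx S S0 *m p <= col_mx S S0)%MS].
Proof. by rewrite inE eXdE eV0dE. Qed.

Lemma levXdef p : levX p = S *m p *m S^T. Proof. by rewrite /Defs.levX eXdE. Qed.
Lemma lev0def p : lev0 p = S0 *m p *m S0^T. Proof. by rewrite /Defs.lev0 eV0dE. Qed.

Lemma levXP p : p \in R -> S *m p = levX p *m S.
Proof.
rewrite parXE => /and3P[_ /submxP[r er] _].
by rewrite levXdef er -[r *m S *m _]mulmxA SS mulmx1.
Qed.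

Lemma lev0P p : p \in R -> S0 *m p = S0 *m p *m S^T *m S + lev0 p *m S0.
Proof.
rewrite parXE => /and3P[_ _]; rewrite mul_col_mx col_mx_sub => /andP[_ /submxP[r er]].
have e : S0 *m p = lsubmx r *m S + rsubmx r *m S0 by rewrite er -mul_row_col hsubmxK.
have e1 : S0 *m p *m S^T = lsubmx r.
  by rewrite e mulmxDl -!mulmxA SS S0S mulmx1 mulmx0 addr0.
have e2 : lev0 p = rsubmx r.
  by rewrite lev0def e mulmxDl -!mulmxA SS0 S0S0 mulmx1 mulmx0 add0r.
by rewrite e1 e2.
Qed.

Lemma levXM : {in R &, forall p q, levX (p *m q) = levX p *m levX q}.
Proof.
by move=> p q pR qR; rewrite levXdef mulmxA (levXP pR) [levX q]levXdef !mulmxA.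
Qed.

Lemma lev0M : {in R &, forall p q, lev0 (p *m q) = lev0 p *m lev0 q}.
Proof.
move=> p q pR qR; rewrite lev0def mulmxA (lev0P pR) [lev0 q]lev0def !mulmxDl.
rewrite -[_ *m S *m q]mulmxA (levXP qR) -[_ *m (_ *m S) *m _]mulmxA -[_ *m S *m S0^T]mulmxA.
by rewrite SS0 !mulmx0 add0r !mulmxA.
Qed.

Lemma levX1 : levX 1%:M = 1%:M. Proof. by rewrite levXdef mulmx1 SS. Qed.
Lemma lev01 : lev0 1%:M = 1%:M. Proof. by rewrite lev0def mulmx1 S0S0. Qed.

Lemma dbl_form0 d : dbl_form (0 : 'M[E]_d) = 0.
Proof. by rewrite /dbl_form oppr0 block_mx0. Qed.

Lemma isom_form0 d (g : 'M[E]_(d + d)) :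
  (g \in isom_grp s (dbl_form (0 : 'M[E]_d))) = (g \in unitmx).
Proof. by rewrite isom_grpE dbl_form0 mulmx0 mul0mx eqxx andbT. Qed.

Lemma levX_isom : {in R, forall p, levX p \in isom_grp s (dbl_form (0 : 'M[E]_k))}.
Proof.
move=> p pR; have gR := parX_mxgroup s J; rewrite isom_form0.
have : levX p *m levX (invmx p) = 1%:M.
  by rewrite -levXM ?(mxgroupV gR) // mulmxV ?(mxgroup_unit gR) // levX1.
by case/mulmx1_unit.
Qed.

(** [X^sq] lies in the radical of the form on [X^sq + V_0^sq], so the [X^sq] part of [S0 *m p]
    contributes nothing. *)
Lemma lev0_isom : {in R, forall p, lev0 p \in isom_grp s (dbl_form J0)}.
Proof.
move=> p pR; have gR := parX_mxgroup s J; rewrite isom_grpE.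
have : lev0 p *m lev0 (invmx p) = 1%:M.
  by rewrite -lev0M ?(mxgroupV gR) // mulmxV ?(mxgroup_unit gR) // lev01.
case/mulmx1_unit=> -> _ /=; apply/eqP; rewrite -{2}S0KS0.
have /isom_grpP pK : p \in G by move: pR; rewrite parXE => /and3P[].
rewrite -pK !mulmxA (lev0P pR); set X := S0 *m p *m S^T; set Y := lev0 p.
rewrite -adjS0 -[_ *m adjmx s p *m _]mulmxA -adjmxM (lev0P pR) -/X -/Y.
rewrite adjmxD !adjmxM adjS adjS0 !mulmxDl !mulmxDr !mulmxA.
rewrite -![X *m S *m K]mulmxA -![X *m (S *m K) *m _]mulmxA SKS SKS0.
rewrite -![Y *m S0 *m K]mulmxA -![Y *m (S0 *m K) *m _]mulmxA S0KS S0KS0.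
by rewrite !mulmx0 !mul0mx !add0r.
Qed.

Lemma expand_abcT p (x : 'M[E]_(n, p)) :
  x = a^T *m (a *m x) + b^T *m (b *m x) + c^T *m (c *m x).
Proof. by rewrite !mulmxA -!mulmxDl abc1 mul1mx. Qed.

(** [X] is isotropic and orthogonal to [V_0], so [a *m J] has only a [c] component: this is the
    duality of [X] and [Y]. *)
Let dual_ac : J \in unitmx -> a *m J *m c^T *m (c *m invmx J *m a^T) = 1%:M.
Proof.
move=> uJ; have e := expand_abc (a *m J).
rewrite Jaa Jab !mul0mx !add0r in e.
by rewrite !mulmxA -e mulmxK // aa.
Qed.

Let dual_ca : J \in unitmx -> c *m J *m a^T *m (a *m invmx J *m c^T) = 1%:M.
Proof.
move=> uJ; have e := expand_abc (c *m J).
rewrite Jcc Jcb !mul0mx !addr0 in e.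
by rewrite !mulmxA -e mulmxK // cc.
Qed.

Let dual_ac' : J \in unitmx -> c *m invmx J *m a^T *m (a *m J *m c^T) = 1%:M.
Proof.
move=> uJ; have e := expand_abcT (J *m c^T).
rewrite [c *m (J *m _)]mulmxA Jcc [b *m (J *m _)]mulmxA Jbc !mulmx0 !addr0 in e.
by rewrite -[a *m J *m _]mulmxA -!mulmxA -e mulKmx // cc.
Qed.

Lemma unit_k_eq_ky : J \in unitmx -> k = ky.
Proof.
move=> uJ; apply/eqP; rewrite eqn_leq.
have r1 := congr1 mxrank (dual_ac uJ); have r2 := congr1 mxrank (dual_ca uJ).
rewrite !mxrank1 in r1 r2; apply/andP; split.
  by rewrite -{1}r1 (leq_trans (mxrankM_maxl _ _)) // rank_leq_col.
by rewrite -{1}r2 (leq_trans (mxrankM_maxl _ _)) // rank_leq_col.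
Qed.

Lemma dim_M : J \in unitmx -> ((k + k + m) + (k + k + m) = n + n)%N.
Proof. by move=> uJ; rewrite -(unit_k_eq_ky uJ) [(k + m + k)%N]addnAC. Qed.

(* For the zero form [Y] is trivial, so the degenerate case needs no separate treatment. *)
Lemma orthX_Y0 d (z : 'M[E]_(d, n)) : z *m J *m a^T = 0 -> z *m c^T = 0.
Proof.
case: degen => [[_ ky0] _|uJ].
  by apply/matrixP=> i j; exfalso; have := ltn_ord j; lia.
rewrite {1}[z]expand_abc !mulmxDl -!mulmxA [a *m (J *m _)]mulmxA Jaa.
rewrite [b *m (J *m _)]mulmxA Jba !mulmx0 !add0r => e.
by rewrite -[z *m _]mulmx1 -(dual_ca uJ) !mulmxA; rewrite !mulmxA in e; rewrite e !mul0mx.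
Qed.

(** [A'] is the contragredient of [A] under the pairing of [X^sq] with [Y^sq]. For the zero form
    [Y^sq] is 0 and the identity serves. *)
Lemma dual_action (A : 'M[E]_(k + k)) : A \in unitmx ->
  exists2 A', A' \in unitmx & A *m (S *m K *m SY^T) *m adjmx s A' = S *m K *m SY^T.
Proof.
move=> uA; case: degen => [[J00 _]|uJ].
  exists 1%:M; first exact: unitmx1.
  by rewrite J00 dbl_form0 mulmx0 mul0mx mulmx0 mul0mx.
have := dbl_form_dblT a c J; move: (S *m K *m SY^T) => H HE.
pose h' := c *m invmx J *m a^T; pose H' := block_mx h' 0 0 (- h').
have HH' : H *m H' = 1%:M.
  rewrite HE mulmx_block !mulmx0 !mul0mx !addr0 add0r mulmxN mulNmx opprK.
  by rewrite dual_ac // -scalar_mx_block.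
have H'H : H' *m H = 1%:M.
  rewrite HE mulmx_block !mulmx0 !mul0mx !addr0 add0r mulmxN mulNmx opprK.
  by rewrite dual_ac' // -scalar_mx_block.
exists (adjmx s (H' *m invmx A *m H)); last first.
  by rewrite adjmxK // !mulmxA -[A *m H *m H']mulmxA HH' mulmx1 mulmxV // mul1mx.
have : adjmx s (H' *m invmx A *m H) *m adjmx s (H' *m A *m H) = 1%:M.
  rewrite -adjmxM !mulmxA -[_ *m H *m H']mulmxA HH' mulmx1 -[_ *m A *m invmx A]mulmxA.
  by rewrite mulmxV // mulmx1 H'H adjmx1.
by case/mulmx1_unit.
Qed.

Lemma eq_mx_flag d (X Y : 'M[E]_(n + n, d)) :
  S *m X = S *m Y -> S0 *m X = S0 *m Y -> SY *m X = SY *m Y -> X = Y.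
Proof.
move=> e1 e2 e3; rewrite -[X]mul1mx -[Y]mul1mx -Ssum !mulmxDl -!mulmxA.
by rewrite e1 e2 e3.
Qed.

Lemma eq_mx_flagT d (X Y : 'M[E]_(d, n + n)) :
  X *m S^T = Y *m S^T -> X *m S0^T = Y *m S0^T -> X *m SY^T = Y *m SY^T -> X = Y.
Proof.
move=> e1 e2 e3; rewrite -[X]mulmx1 -[Y]mulmx1 -Ssum !mulmxDr !mulmxA.
by rewrite e1 e2 e3.
Qed.

(** The lift is block diagonal with blocks [A], [B] and the dual action [A'] on [Y^sq]; the isometry
    condition is tested on the nine pairs of blocks. *)
Lemma levi_lift A B : A \in isom_grp s (dbl_form (0 : 'M[E]_k)) ->
  B \in isom_grp s (dbl_form J0) -> exists2 p, p \in R & levX p = A /\ lev0 p = B.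
Proof.
rewrite isom_form0 => uA BG; have uB := isom_grp_unit BG.
have [A' uA' AA'] := dual_action uA.
pose lev A B A' := S^T *m A *m S + S0^T *m B *m S0 + SY^T *m A' *m SY.
have levS A1 B1 A1' : S *m lev A1 B1 A1' = A1 *m S.
  by rewrite !mulmxDr !mulmxA SS SS0 SSY !mul0mx !addr0 mul1mx.
have levS0 A1 B1 A1' : S0 *m lev A1 B1 A1' = B1 *m S0.
  by rewrite !mulmxDr !mulmxA S0S S0S0 S0SY !mul0mx !addr0 add0r mul1mx.
have levSY A1 B1 A1' : SY *m lev A1 B1 A1' = A1' *m SY.
  by rewrite !mulmxDr !mulmxA SYS SYS0 SYSY !mul0mx !add0r mul1mx.
pose p := lev A B A'.
have up : p \in unitmx.
  have : p *m lev (invmx A) (invmx B) (invmx A') = 1%:M.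
    by apply: eq_mx_flag; rewrite mulmx1 mulmxA ?levS ?levS0 ?levSY -mulmxA
      ?levS ?levS0 ?levSY mulmxA mulmxV // mul1mx.
  by case/mulmx1_unit.
have AA2 : A' *m (SY *m K *m S^T) *m adjmx s A = SY *m K *m S^T.
  have e : SY *m K *m S^T = eps *: adjmx s (S *m K *m SY^T).
    by rewrite !adjmxM -adjSY adjmxK // adjS scalemxAr scalemxAl -Ksym mulmxA.
  rewrite e -{2}AA' !adjmxM adjmxK // -scalemxAr -scalemxAl; congr (_ *: _).
  by rewrite !mulmxA.
have pG : p \in G.
  rewrite isom_grpE up; apply/eqP.
  have key d1 d2 (U1 : 'M_(d1, n + n)) (U2 : 'M_(d2, n + n)) A1 A2 :
      U1 *m p = A1 *m U1 -> U2 *m p = A2 *m U2 -> adjmx s U2 = U2^T ->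
      U1 *m (p *m K *m adjmx s p) *m U2^T = A1 *m (U1 *m K *m U2^T) *m adjmx s A2.
    move=> e1 e2 <-; rewrite -[U1 *m _ *m adjmx s U2]mulmxA -[_ *m adjmx s p *m _]mulmxA.
    by rewrite -adjmxM e2 adjmxM !mulmxA e1.
  have kS := levS A B A'; have kS0 := levS0 A B A'; have kSY := levSY A B A'.
  apply: eq_mx_flag; apply: eq_mx_flagT.
  - by rewrite (key _ _ _ _ _ _ kS kS adjS) SKS mulmx0 mul0mx.
  - by rewrite (key _ _ _ _ _ _ kS kS0 adjS0) SKS0 mulmx0 mul0mx.
  - by rewrite (key _ _ _ _ _ _ kS kSY adjSY) AA'.
  - by rewrite (key _ _ _ _ _ _ kS0 kS adjS) S0KS mulmx0 mul0mx.
  - by rewrite (key _ _ _ _ _ _ kS0 kS0 adjS0) S0KS0 (isom_grpP BG).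
  - by rewrite (key _ _ _ _ _ _ kS0 kSY adjSY) S0KSY mulmx0 mul0mx.
  - by rewrite (key _ _ _ _ _ _ kSY kS adjS) AA2.
  - by rewrite (key _ _ _ _ _ _ kSY kS0 adjS0) SYKS0 mulmx0 mul0mx.
  - by rewrite (key _ _ _ _ _ _ kSY kSY adjSY) SYKSY mulmx0 mul0mx.
exists p.
  rewrite parXE pG /p levS mul_col_mx levS levS0 submxMl col_mx_sub /=.
  by rewrite !mulmx_sub ?sub_col_mxl ?sub_col_mxr.
by rewrite levXdef lev0def /p levS levS0 -!mulmxA SS S0S0 !mulmx1.
Qed.

(** * Determinants on the flag and agreement of the characters *)

Lemma half2 : (2 : E)^-1 * 2 = 1. Proof. by rewrite mulVf. Qed.

(** In a basis adapted to [V^Delta + V^nabla] the matrix is block triangular; the second factor is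
    the determinant on the quotient by the diagonal. *)
Lemma det_diag_antidiag d (A : 'M[E]_(d + d)) r : diagmx d *m A = r *m diagmx d ->
  \det A = \det r * \det (2^-1 *: (antidiag E d *m A *m (antidiag E d)^T)).
Proof.
move=> e; pose U := col_mx (diagmx d) (antidiag E d).
have UU : U *m (2^-1 *: U^T) = 1%:M.
  rewrite -scalemxAr tr_col_mx mul_col_row diag_diagT diag_antidiagT antidiag_diagT.
  by rewrite antidiag_antidiagT scale_block_mx !scaler0 !scalerA half2 !scale1r -scalar_mx_block.
rewrite -(det_conj A UU); last first.
  by rewrite -scalemxAl tr_col_mx mul_row_col diagT_add scalerA half2 scale1r.
rewrite -scalemxAr mul_col_mx tr_col_mx mul_col_row e -!mulmxA diag_diagT diag_antidiagT.
by rewrite mulmx0 scale_block_mx scaler0 det_lblock -scalemxAr mulmx1 scalerA half2 scale1r.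
Qed.

Lemma det_flag (r : 'M[E]_n) : a *m r *m b^T = 0 -> a *m r *m c^T = 0 -> b *m r *m c^T = 0 ->
  \det r = \det (a *m r *m a^T) * \det (b *m r *m b^T) * \det (c *m r *m c^T).
Proof.
move=> e1 e2 e3; have W := abcT E k m ky.
rewrite -(det_conj r W (mulmx1C W)).
have -> : col_mx (col_mx a b) c *m r = col_mx (col_mx (a *m r) (b *m r)) (c *m r).
  by rewrite !mul_col_mx.
rewrite tr_col_mx mul_col_row [X in block_mx _ X]mul_col_mx e2 e3 col_mx0 det_lblock.
by rewrite tr_col_mx mul_col_row e1 det_lblock.
Qed.

Lemma col_flagT : ky = 0%N -> (col_mx S S0)^T *m col_mx S S0 = 1%:M.
Proof.
move=> ky0; rewrite tr_col_mx mul_row_col -Ssum.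
suff -> : SY = 0 by rewrite mulmx0 addr0.
by apply/matrixP=> i j; exfalso; have := ltn_ord i; lia.
Qed.

Lemma det_levi p : ky = 0%N -> p \in R -> \det p = \det (levX p) * \det (lev0 p).
Proof.
move=> ky0 pR; pose U := col_mx S S0.
have UU : U *m U^T = 1%:M.
  by rewrite tr_col_mx mul_col_row SS SS0 S0S S0S0 -scalar_mx_block.
rewrite -(det_conj p UU (col_flagT ky0)) mul_col_mx tr_col_mx mul_col_row -levXdef -lev0def.
by rewrite (levXP pR) -mulmxA SS0 mulmx0 det_lblock.
Qed.

(** The image of [X^Delta] is computed once inside [V^Delta] and once inside [X^sq], and similarly
    for [V_0^Delta]; comparison makes [t] block triangular. *)
Lemma flag_action r : r \in siegel s J -> r \in R ->
  let t := diag_action r in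
  [/\ diagmx k *m levX r = (a *m t *m a^T) *m diagmx k,
      diagmx m *m lev0 r = (b *m t *m b^T) *m diagmx m,
      a *m t *m b^T = 0, a *m t *m c^T = 0 & b *m t *m c^T = 0].
Proof.
move=> rP rR t; have er : V *m r = t *m V := siegelP rP.
have dK d (x : 'M[E]_(d, ky)) : x *m diagmx ky = 0 -> x = 0.
  by move/(congr1 lsubmx); rewrite /diagmx mul_mx_row mulmx1 row_mxKl linear0.
have dM d (x : 'M[E]_(d, m)) : x *m diagmx m = 0 -> x = 0.
  by move/(congr1 lsubmx); rewrite /diagmx mul_mx_row mulmx1 row_mxKl linear0.
have e1 : diagmx k *m S *m r = a *m t *m V by rewrite diag_dbl -!mulmxA er.
have e2 : diagmx m *m S0 *m r = b *m t *m V by rewrite diag_dbl -!mulmxA er.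
split.
- by rewrite levXdef !mulmxA e1 -mulmxA diag_dblT !mulmxA.
- by rewrite lev0def !mulmxA e2 -mulmxA diag_dblT !mulmxA.
- apply: dM; rewrite -[_ *m diagmx m]mulmxA -diag_dblT mulmxA -e1 -[_ *m S *m r]mulmxA (levXP rR).
  by rewrite -!mulmxA SS0 !mulmx0.
- apply: dK; rewrite -[_ *m diagmx ky]mulmxA -diag_dblT mulmxA -e1 -[_ *m S *m r]mulmxA (levXP rR).
  by rewrite -!mulmxA SSY !mulmx0.
- apply: dK; rewrite -[_ *m diagmx ky]mulmxA -diag_dblT mulmxA -e2 -[_ *m S0 *m r]mulmxA (lev0P rR).
  by rewrite mulmxDr mulmxDl -!mulmxA SSY S0SY !mulmx0 addr0.
Qed.

Lemma siegel_par_levels r : r \in siegel s J -> r \in R ->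
  levX r \in siegel s (0 : 'M[E]_k) /\ lev0 r \in siegel s J0.
Proof.
move=> rP rR; have [e1 e2 _ _ _] := flag_action rP rR.
by split; rewrite inE ?levX_isom ?lev0_isom //= ?e1 ?e2 submxMl.
Qed.

(** [r] preserves the pairing of [X^sq / X^Delta] with [Y^Delta], so its determinants on the two are
    inverse up to [s]. *)
Lemma dual_det r : J \in unitmx -> r \in siegel s J -> r \in R ->
  \det (c *m diag_action r *m c^T)
  * s (\det (levX r) / \det (a *m diag_action r *m a^T)) = 1.
Proof.
move=> uJ rP rR; have [e1 e2 z1 z2 z3] := flag_action rP rR.
have := siegelP rP; set t := diag_action r in e1 e2 z1 z2 z3 * => er.
have nX : \det (a *m t *m a^T) != 0.
  have [+ _] := siegel_par_levels rP rR => /(@diag_action_det _ s).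
  by rewrite (diag_action_eq e1).
rewrite (det_diag_antidiag e1) mulrAC mulfV // mul1r.
(* [T] is the action on [X^sq / X^Delta], read on [X^nabla], and [h] is the pairing of [X] with
   [Y]. *)
set T := 2^-1 *: _; set h := a *m J *m c^T.
have aJ : a *m J = h *m c by rewrite {1}[a *m J]expand_abc Jaa Jab !mul0mx !add0r.
have key : T *m h *m adjmx s (c *m t *m c^T) = h.
  have rK : r *m K *m adjmx s r = K by apply: isom_grpP; move: rP; rewrite inE => /andP[].
  have e3 : antidiag E k *m S *m r *m K *m adjmx s (c *m V *m r) = 2 *: h.
    rewrite !adjmxM adjmx_sel adjmx_diag antidiag_dbl.
    rewrite -!mulmxA [r *m (K *m _)]mulmxA [r *m K *m _]mulmxA rK !mulmxA.
    rewrite -[a *m Z *m K]mulmxA antidiag_form !mulmxA -[_ *m V *m _]mulmxA diag_diagT.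
    by rewrite -scalemxAr mulmx1 -scalemxAl.
  apply: (scalerI two_neq0); rewrite -e3 -[c *m V *m r]mulmxA er [c *m (_ *m V)]mulmxA.
  rewrite -[antidiag E k *m S *m r]mulmxA (levXP rR) [adjmx s (_ *m V)]adjmxM adjmx_diag !mulmxA.
  rewrite -[_ *m S *m K]mulmxA -[_ *m (S *m K) *m _]mulmxA SKV.
  rewrite !mulmxA -[_ *m a *m J]mulmxA aJ !mulmxA.
  rewrite -!scalemxAl scalerA mulfV // scale1r.
  by rewrite [in LHS]adjmxM adjcT !mulmxA.
have := congr1 (mulmx^~ (c *m invmx J *m a^T)) key; rewrite dual_ac // -[T *m h *m _]mulmxA.
rewrite -[_ *m (c *m _ *m _)]mulmxA => /(congr1 determinant).
rewrite det_mulmx det1 (det_conj _ (dual_ac uJ) (dual_ac' uJ)) det_adjmx => e.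
by rewrite -(rmorph1 s) -e rmorphM hs mulrC.
Qed.

Variables (C : fieldType) (chi : E -> C).
Hypotheses (chi0 : forall x : E, x != 0 -> chi x != 0)
  (chiM : forall x y : E, x != 0 -> y != 0 -> chi (x * y) = chi x * chi y).

Lemma J0_eq0 : J \in unitmx -> J0 = 0 -> m = 0%N.
Proof.
move=> uJ; rewrite /formV0 => e.
have : b *m J = 0 by rewrite [b *m J]expand_abc Jba e Jbc !mul0mx !addr0.
move/(congr1 (mulmx^~ (invmx J))); rewrite mulmxK // mul0mx => b0.
by have := bb; rewrite b0 mul0mx => /(congr1 mxrank); rewrite mxrank0 mxrank1.
Qed.

Lemma J_eq0_dim : J = 0 -> ky = 0%N.
Proof.
(* A matrix that is both zero and invertible has size 0. *)
move=> J00; case: degen => [[]//|/mxrank_unit]; rewrite J00 mxrank0 => e.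
lia.
Qed.

Lemma ps_factor_V0 (p : 'M[E]_(m + m)) : J \in unitmx ->
  ps_factor s chi (J0 == 0) p = chi (\det (diag_action p)).
Proof.
move=> uJ; case: eqP => [/(J0_eq0 uJ) m0|_]; last by rewrite ps_factorE mulr1.
by rewrite (ps_factor_dim0 s chi0 chiM) // det_dim0 // (chi1 chi0 chiM).
Qed.

Lemma J0_of0 : J = 0 -> J0 = 0.
Proof. by move=> ->; rewrite /formV0 mulmx0 mul0mx. Qed.

(** For the zero form all determinants multiply along the flag. For a nondegenerate form, [dual_det]
    turns the [Y] block of [V^Delta] into the factor on [X^sq / X^Delta]. *)
Lemma siegel_par_char r : r \in siegel s J -> r \in R ->
  ps_factor s chi (J == 0) r
  = ps_factor s chi true (levX r) * ps_factor s chi (J0 == 0) (lev0 r).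
Proof.
move=> rP rR; have [e1 e2 z1 z2 z3] := flag_action rP rR.
have [lXP l0P] := siegel_par_levels rP rR.
have nX := diag_action_det lXP; have n0 := diag_action_det l0P.
have nt := diag_action_det rP.
have uX : \det (levX r) != 0 by have := isom_grp_unit (levX_isom rR); rewrite unitmxE unitfE.
have u0 : \det (lev0 r) != 0 by have := isom_grp_unit (lev0_isom rR); rewrite unitmxE unitfE.
have dt := det_flag z1 z2 z3.
have [J00|nJ] := eqVneq J 0.
  have ky0 := J_eq0_dim J00; rewrite J0_of0 // eqxx.
  rewrite !ps_factorE (det_levi ky0 rR) dt (diag_action_eq e1) (diag_action_eq e2).
  rewrite (det_dim0 (c *m _ *m _) ky0) mulr1.
  rewrite (diag_action_eq e1) in nX; rewrite (diag_action_eq e2) in n0.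
  rewrite -mulf_div rmorphM !chiM ?fmorph_eq0 ?mulf_neq0 ?invr_eq0 //.
  by rewrite invfM mulrACA.
have uJ : J \in unitmx by case: degen => [[]|//]; move/eqP: nJ.
have := dual_det uJ rP rR.
rewrite ps_factor_V0 // !ps_factorE dt (diag_action_eq e1) (diag_action_eq e2).
rewrite (diag_action_eq e1) in nX; rewrite (diag_action_eq e2) in n0.
set dc := \det (c *m _ *m _); set x := s _ => dx.
have nx : x != 0 by rewrite fmorph_eq0 mulf_neq0 ?invr_eq0.
have -> : dc = x^-1 by apply: (mulIf nx); rewrite dx mulVf.
rewrite !chiM ?mulf_neq0 ?invr_eq0 // (chiV chi0 chiM) // mulr1.
by rewrite mulrAC.
Qed.

(** * Elements that separate the two characters *)

Local Notation M := (col_mx S (b *m V)).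

(** On [M] the element [q] is block triangular, with diagonal blocks [levX q] and the action of
    [lev0 q] on [V_0^Delta]. *)
Lemma flag_dets q rS rD rM : q \in G -> S *m q = rS *m S ->
  a *m V *m q = rD *m (a *m V) -> M *m q = rM *m M ->
  (col_mx S S0 *m q <= col_mx S S0)%MS ->
  [/\ [/\ q \in R, levX q \in siegel s (0 : 'M[E]_k) & lev0 q \in siegel s J0],
      \det (levX q) = \det rS, \det (diag_action (levX q)) = \det rD
      & \det rM = \det rS * \det (diag_action (lev0 q))].
Proof.
move=> qG eS eD eM eS0.
have qR : q \in R by rewrite parXE qG eS submxMl.
have lXE : levX q = rS by rewrite levXdef eS -mulmxA SS mulmx1.
have dX : diagmx k *m levX q = rD *m diagmx k.
  by rewrite levXdef !mulmxA diag_dbl eD -!mulmxA diag_dblT [a *m (_ *m _)]mulmxA aa mul1mx.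
move: eM; rewrite -{1}[rM]submxK mul_col_mx mul_block_col => /eq_col_mx[].
set ul := ulsubmx rM; set ur := ursubmx rM; set dl := dlsubmx rM; set dr := drsubmx rM.
rewrite eS => eu ed.
have ur0 : ur = 0.
  have := congr1 (mulmx^~ S0^T) eu; rewrite mulmxDl -!mulmxA SS0 !mulmx0 add0r.
  rewrite diag_dblT !mulmxA -[ur *m b *m _]mulmxA bb mulmx1.
  by move/esym/(congr1 lsubmx); rewrite /diagmx mul_mx_row mulmx1 row_mxKl linear0.
have ulE : ul = rS.
  have := congr1 (mulmx^~ S^T) eu; rewrite ur0 mul0mx addr0 -!mulmxA SS !mulmx1.
  by move->.
have d0 : diagmx m *m lev0 q = dr *m diagmx m.
  rewrite lev0def !mulmxA diag_dbl ed mulmxDl -mulmxA SS0 mulmx0 add0r.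
  by rewrite -mulmxA bVS0.
split; rewrite ?lXE //.
- split=> //; rewrite inE ?lev0_isom ?levX_isom //= ?dX ?d0 ?submxMl //.
  by rewrite -lXE levX_isom // lXE -lXE dX submxMl.
- by rewrite -lXE (diag_action_eq dX).
- by rewrite (diag_action_eq d0) -[rM]submxK -/ul -/ur ur0 det_lblock ulE.
Qed.

Lemma conj_siegel w q rL : w \in G -> q \in G ->
  V *m invmx w *m q = rL *m (V *m invmx w) ->
  [/\ invmx w *m q *m w \in siegel s J, diag_action (invmx w *m q *m w) = rL
     & \det (invmx w *m q *m w) = \det q].
Proof.
move=> wG qG e; have gG := isom_mxgroup s K; have uw := isom_grp_unit wG.
have e' : V *m (invmx w *m q *m w) = rL *m V by rewrite !mulmxA e !mulmxA mulmxKV.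
split; first by rewrite inE !(mxgroupM gG) ?(mxgroupV gG) //= e' submxMl.
  exact: diag_action_eq.
by apply: det_conj; rewrite ?mulmxV ?mulVmx.
Qed.

(* The function on [G] attached to an intertwiner vanishes on the double coset of [w]. *)
Definition violates w := exists q, [/\ q \in R, levX q \in siegel s (0 : 'M[E]_k),
  lev0 q \in siegel s J0 & invmx w *m q *m w \in siegel s J /\
    ps_factor s chi (J == 0) (invmx w *m q *m w) <>
    ps_factor s chi true (levX q) * ps_factor s chi (J0 == 0) (lev0 q)].

(** Both characters are expressed by determinants on [L], [X^Delta], [X^sq] and [M]; the quotient
    [M / X^sq] accounts for [V_0^Delta]. *)
Lemma violates_dets w q rL rS rD rM : w \in G -> q \in G -> S *m q = rS *m S ->
  a *m V *m q = rD *m (a *m V) -> M *m q = rM *m M ->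
  (col_mx S S0 *m q <= col_mx S S0)%MS ->
  V *m invmx w *m q = rL *m (V *m invmx w) ->
  (if J == 0 then chi (\det rL) * (chi (s (\det q / \det rL)))^-1 else chi (\det rL)) <>
  chi (\det rD) * (chi (s (\det rS / \det rD)))^-1 *
  (if J == 0 then chi (\det rM / \det rS) * (chi (s (\det q / \det rM)))^-1
   else chi (\det rM / \det rS)) ->
  violates w.
Proof.
move=> wG qG eS eD eM eS0 eL bad.
have [[qR qX q0] dS dD dM] := flag_dets qG eS eD eM eS0.
have [pP pL pd] := conj_siegel wG qG eL.
exists q; split=> //; split=> // e; apply: bad; move: e.
have nS : \det rS != 0.
  by rewrite -dS; have := isom_grp_unit (levX_isom qR); rewrite unitmxE unitfE.
have e0 : \det (diag_action (lev0 q)) = \det rM / \det rS.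
  by rewrite dM mulrAC mulfV // mul1r.
have [J00|nJ] := eqVneq J 0.
  rewrite J0_of0 // eqxx !ps_factorE pL pd dS dD e0 => ->; congr (_ * (_ * (chi (s _))^-1)).
  (* For the zero form, [V_0^sq / V_0^Delta] is the quotient of the whole space by [M], with
     determinant [\det q / \det rM]. *)
  rewrite (det_levi (J_eq0_dim J00) qR) dS; have := diag_action_det q0; rewrite e0.
  rewrite mulf_eq0 negb_or => /andP[nM _]; field.
  by rewrite nM.
have uJ : J \in unitmx by case: degen => [[]|//]; move/eqP: nJ.
by rewrite ps_factor_V0 // !ps_factorE pL dS dD e0 mulr1.
Qed.

Lemma row_free_diag d : row_free (diagmx d : 'M[E]_(d, d + d)).
Proof.
apply/row_freeP; exists (2^-1 *: (diagmx d)^T).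
by rewrite -scalemxAr diag_diagT scalerA half2 scale1r.
Qed.

Lemma row_free_M : row_free M.
Proof.
apply/row_freeP; exists (row_mx S^T (S0^T *m (2^-1 *: (diagmx m)^T))).
rewrite mul_col_row SS mulmxA SS0 mul0mx bVS mulmxA bVS0.
rewrite -scalemxAr diag_diagT scalerA half2 scale1r.
by rewrite -scalar_mx_block.
Qed.

Lemma form_M : M *m K *m adjmx s M = 0.
Proof.
have -> : adjmx s M = row_mx S^T (V^T *m b^T).
  by rewrite /adjmx map_col_mx tr_col_mx -!/(adjmx s _) adjS adjmxM adjmx_diag adjb.
rewrite mul_col_mx mul_col_row SKS !mulmxA SKV -[_ *m a *m J]mulmxA -[_ *m (a *m J) *m _]mulmxA.
rewrite Jab mulmx0 -!mulmxA [V *m (K *m S^T)]mulmxA VKS.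
rewrite [V *m (K *m (_ *m _))]mulmxA [V *m K *m (_ *m _)]mulmxA VKV mul0mx mulmx0 !mulmxA Jba.
by rewrite mul0mx block_mx0.
Qed.

Lemma form_L w : w \in G -> V *m invmx w *m K *m adjmx s (V *m invmx w) = 0.
Proof.
move=> wG; have /isom_grpP wK := mxgroupV (isom_mxgroup s K) wG.
rewrite adjmxM adjmx_diag -!mulmxA [invmx w *m (K *m _)]mulmxA.
by rewrite [invmx w *m K *m _]mulmxA wK mulmxA VKV.
Qed.

(** * Dilations by an element [t] with [chi (t * s t) != 1] *)

Section Transvection.
Variable t : E.
Hypotheses (nt : t != 0) (chit : chi (t * s t) != 1).

Let chi_t : chi t <> (chi (s t))^-1.
Proof.
move=> e; move/eqP: chit; apply.
by rewrite chiM ?fmorph_eq0 // e mulVf // chi0 ?fmorph_eq0.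
Qed.

Let one := chi1 chi0 chiM.

(** [q] scales [x] by [t] and fixes the kernel of [u], so its determinant on a subspace is [t] if
    [x] belongs to it and 1 if [u] vanishes on it. *)
Lemma violates_zero w (x : 'rV[E]_(n + n)) (u : 'cV[E]_(n + n)) :
  w \in G -> J = 0 -> x *m u = 1%:M ->
  [\/ [/\ (x <= V *m invmx w)%MS, (x <= S)%MS & a *m V *m u = 0],
      (x <= a *m V)%MS /\ V *m invmx w *m u = 0
    | (x <= V *m invmx w)%MS /\ M *m u = 0] -> violates w.
Proof.
(* The zero term gives [q] the two-term shape of [stab_rank1] and [stab_trivial]. *)
move=> wG J00 xu; pose q := 1%:M + ((t - 1) *: u) *m x + 0 *m (0 : 'rV[E]_(n + n)).
have xu1 : 1 + (x *m ((t - 1) *: u)) 0 0 = t.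
  by rewrite -scalemxAr xu !mxE eqxx mulr1 addrC subrK.
have dq : \det q = t.
  by rewrite /q mul0mx addr0 det_add1C det_mx11 mxE mxE eqxx xu1.
have qG : q \in G.
  by rewrite isom_grpE unitmxE dq unitfE nt J00 dbl_form0 mulmx0 mul0mx eqxx.
have top d (U : 'M[E]_(d, n + n)) : (x <= U)%MS ->
    exists2 r, U *m q = r *m U & \det r = t.
  move=> xU; have U0 : U *m (0 : 'cV[E]_(n + n)) = 0 by rewrite mulmx0.
  by have := stab_rank1 0 ((t - 1) *: u) U0 xU; rewrite xu1.
have triv d (U : 'M[E]_(d, n + n)) : U *m u = 0 -> U *m q = 1%:M *m U.
  by move=> Uu; apply: stab_trivial; rewrite ?mulmx0 // -scalemxAr Uu scaler0.
have full : (col_mx S S0 *m q <= col_mx S S0)%MS.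
  by rewrite -[q]mulmx1 -(col_flagT (J_eq0_dim J00)) !mulmxA submxMl.
have SM d (x' : 'M[E]_(d, n + n)) : (x' <= S)%MS -> (x' <= M)%MS.
  by move=> h; apply: submx_trans h (sub_col_mxl _ _).
have DS d (x' : 'M[E]_(d, n + n)) : (x' <= a *m V)%MS -> (x' <= S)%MS.
  by move=> h; apply: submx_trans h _; rewrite -diag_dbl submxMl.
have s1 : s 1 = 1 := rmorph1 s.
have simp := (one, s1, divr1, divff nt, invr1, mulr1, mul1r).
case=> [[xL xS Du]|[xD Lu]|[xL Mu]].
- have [rL eL dL] := top _ _ xL; have [rS eS dS] := top _ _ xS.
  have [rM eM dM] := top _ _ (SM _ _ xS).
  apply: (violates_dets wG qG eS (triv _ _ Du) eM full eL).
  by rewrite J00 eqxx dq dL dS dM det1 !simp.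
- have [rS eS dS] := top _ _ (DS _ _ xD); have [rD eD dD] := top _ _ xD.
  have [rM eM dM] := top _ _ (SM _ _ (DS _ _ xD)).
  apply: (violates_dets wG qG eS eD eM full (triv _ _ Lu)).
  rewrite J00 eqxx dq dD dS dM det1 !simp; exact/nesym.
- have [rL eL dL] := top _ _ xL.
  have Su : S *m u = 0 by move: Mu; rewrite mul_col_mx -col_mx0 => /eq_col_mx[].
  have Du : a *m V *m u = 0 by rewrite -diag_dbl -mulmxA Su mulmx0.
  apply: (violates_dets wG qG (triv _ _ Su) (triv _ _ Du) (triv _ _ Mu) full eL).
  by rewrite J00 eqxx dq dL !det1 !simp.
Qed.

(** * Hyperbolic pairs for a nondegenerate form *)

Section Nondegenerate.
Hypothesis uJ : J \in unitmx.

Let uK : K \in unitmx.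
Proof.
suff /mulmx1_unit[] : K *m dbl_form (invmx J) = 1%:M by [].
rewrite mulmx_block !mulmx0 !mul0mx !addr0 add0r mulmxN mulNmx opprK mulmxV //.
by rewrite -scalar_mx_block.
Qed.

Let adjK : adjmx s K = eps *: K.
Proof. by rewrite {2}Ksym scalerA eps2 scale1r. Qed.

Lemma form_swap d e (A : 'M[E]_(d, n + n)) (B : 'M[E]_(e, n + n)) :
  A *m K *m adjmx s B = eps *: adjmx s (B *m K *m adjmx s A).
Proof.
by rewrite !adjmxM adjmxK // adjK mulmxA -scalemxAr -scalemxAl scalerA eps2 scale1r.
Qed.

Lemma isotropic_sub d e f (A : 'M[E]_(d, n + n)) (U : 'M[E]_(e, n + n)) (x : 'M[E]_(f, n + n)) :
  A *m K *m adjmx s U = 0 -> (x <= U)%MS -> A *m K *m adjmx s x = 0.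
Proof. by move=> e0 /submxP[v ->]; rewrite adjmxM mulmxA e0 mul0mx. Qed.

(** The orthogonal complement of [U] contains [U] and has the same dimension. *)
Lemma lagrangian_max d e (U : 'M[E]_(d, n + n)) (x : 'M[E]_(e, n + n)) :
  U *m K *m adjmx s U = 0 -> row_free U -> (d + d = n + n)%N ->
  U *m K *m adjmx s x = 0 -> (x <= U)%MS.
Proof.
move=> U0 fU dd xU.
have xU' : x *m (K *m adjmx s U) = 0 by rewrite mulmxA form_swap xU adjmx0 scaler0.
have UU : (U <= kermx (K *m adjmx s U))%MS by apply/sub_kermxP; rewrite mulmxA.
have rW : \rank (K *m adjmx s U) = d.
  by rewrite eqmxMfull ?row_full_unit // /adjmx mxrank_tr mxrank_map; apply/eqP.
have := mxrank_leqif_eq UU; rewrite mxrank_ker rW.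
have -> : \rank U = d by apply/eqP.
have -> : (n + n - d = d)%N by rewrite -dd addnK.
move=> /leqif_refl/eqmxP e1.
by rewrite e1; apply/sub_kermxP.
Qed.

Lemma dual_vector d (U : 'M[E]_(d, n + n)) (x : 'rV[E]_(n + n)) : ~~ (x <= U)%MS ->
  exists y : 'rV[E]_(n + n), U *m K *m adjmx s y = 0 /\ x *m K *m adjmx s y = 1%:M.
Proof.
case/separating_functional=> u [Uu xu]; exists (adjmx s (invmx K *m u)).
by rewrite adjmxK // -!mulmxA !(mulKVmx uK).
Qed.

(** This map scales [x] by [t] and [y] by the inverse of [s t], and fixes their orthogonal
    complement. The factor [eps] compensates for the value [eps] of the pairing of [y] with [x]. *)
Lemma hyperbolic_isom (x y : 'rV[E]_(n + n)) :
  x *m K *m adjmx s y = 1%:M -> x *m K *m adjmx s x = 0 -> y *m K *m adjmx s y = 0 ->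
  1%:M + ((t - 1) *: (K *m adjmx s y)) *m x
       + ((((s t)^-1 - 1) * eps) *: (K *m adjmx s x)) *m y \in G.
Proof.
move=> xy xx yy; have yx : y *m K *m adjmx s x = eps%:M.
  by rewrite form_swap xy adjmx1 scale_scalar_mx mulr1.
set al := t - 1; set be := _ * eps; set q := _ + _.
set X := adjmx s x in xx yx q *; set Y := adjmx s y in xy yy q *.
(* Multiplying [P] and [Q] by the terms of [adjmx s q] gives only multiples of [P] and [Q], so the
   isometry condition reduces to scalar identities in [t] and [s t]. *)
pose P := K *m Y *m x *m K; pose Q := K *m X *m y *m K.
have qK : q *m K = K + al *: P + be *: Q.
  by rewrite /q !mulmxDl mul1mx -!scalemxAl.
have qA : adjmx s q = 1%:M + (s al * eps) *: (X *m y *m K) + (s be * eps) *: (Y *m x *m K).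
  rewrite /q !adjmxD adjmx1 !adjmxM !adjmxZ !adjmxM -/X -/Y !(adjmxK hs) adjK.
  by rewrite -!scalemxAr !scalerA !mulmxA.
have PX : P *m (X *m y *m K) = 0.
  rewrite /P !mulmxA -[_ *m K *m X]mulmxA -[_ *m x *m _]mulmxA [x *m (K *m X)]mulmxA xx.
  by rewrite mulmx0 !mul0mx.
have PY : P *m (Y *m x *m K) = P.
  rewrite /P !mulmxA -[_ *m K *m Y]mulmxA -[_ *m x *m (K *m Y)]mulmxA.
  by rewrite [x *m (K *m Y)]mulmxA xy mulmx1.
have QX : Q *m (X *m y *m K) = eps *: Q.
  rewrite /Q !mulmxA -[_ *m K *m X]mulmxA -[_ *m y *m (K *m X)]mulmxA [y *m (K *m X)]mulmxA yx.
  by rewrite mul_mx_scalar -!scalemxAl.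
have QY : Q *m (Y *m x *m K) = 0.
  rewrite /Q !mulmxA -[_ *m K *m Y]mulmxA -[_ *m y *m _]mulmxA [y *m (K *m Y)]mulmxA yy.
  by rewrite mulmx0 !mul0mx.
have KX : K *m (X *m y *m K) = Q by rewrite !mulmxA.
have KY : K *m (Y *m x *m K) = P by rewrite !mulmxA.
have nst : s t != 0 by rewrite fmorph_eq0.
have isom : q *m K *m adjmx s q = K.
  rewrite qK qA !mulmxDr mulmx1 -!scalemxAr !mulmxDl -!scalemxAl KX KY PX PY QX QY.
  rewrite !scaler0 ?addr0 ?add0r !scalerA.
  have -> : be * eps = (s t)^-1 - 1 by rewrite /be -mulrA eps2 mulr1.
  have -> : s be * eps = t^-1 - 1.
    by rewrite /be rmorphM rmorphB rmorph1 fmorphV hs seps -mulrA eps2 mulr1.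
  have -> : s al = s t - 1 by rewrite rmorphB rmorph1.
  clear qK KX KY PX PY QX QY; rewrite /be /al; move: K P Q => K1 P1 Q1.
  by apply/matrixP=> i j; rewrite !mxE; field; apply/andP; split.
rewrite isom_grpE isom eqxx andbT.
have : q *m (K *m adjmx s q *m invmx K) = 1%:M by rewrite !mulmxA isom mulmxV.
by case/mulmx1_unit.
Qed.

(** A subspace containing [x] and orthogonal to it has determinant [t], one containing [y] and
    orthogonal to it has determinant [t'], and one orthogonal to both has determinant 1. *)
Lemma violates_pair w (x y : 'rV[E]_(n + n)) : w \in G ->
  x *m K *m adjmx s y = 1%:M -> x *m K *m adjmx s x = 0 -> y *m K *m adjmx s y = 0 ->
  [\/ [/\ (x <= V *m invmx w)%MS, (x <= S)%MS & a *m V *m K *m adjmx s y = 0],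
      [/\ (x <= a *m V)%MS, (y <= V *m invmx w)%MS & V *m invmx w *m K *m adjmx s y = 0]
    | [/\ (x <= V *m invmx w)%MS, (x <= col_mx S S0)%MS, (y <= M)%MS
        & M *m K *m adjmx s y = 0]] -> violates w.
Proof.
move=> wG xy xx yy; pose t' := (s t)^-1; pose L := V *m invmx w.
pose u := (t - 1) *: (K *m adjmx s y); pose v := ((t' - 1) * eps) *: (K *m adjmx s x).
pose q := 1%:M + u *m x + v *m y; have qG : q \in G := hyperbolic_isom xy xx yy.
have yx : y *m K *m adjmx s x = eps%:M.
  by rewrite form_swap xy adjmx1 scale_scalar_mx mulr1.
have nJ : (J == 0) = false.
  apply: contra_eqF xy => /eqP ->; rewrite dbl_form0 mulmx0 mul0mx eq_sym.
  by rewrite -mxrank_eq0 mxrank1.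
have top d (U : 'M[E]_(d, n + n)) : (x <= U)%MS -> U *m K *m adjmx s x = 0 ->
    exists2 r, U *m q = r *m U & \det r = t.
  move=> xU Ux; have Uv : U *m v = 0 by rewrite -scalemxAr mulmxA Ux scaler0.
  have := stab_rank1 y u Uv xU; rewrite -scalemxAr mulmxA xy.
  by rewrite !mxE eqxx mulr1 [1 + (t - 1)]addrC subrK.
have bot d (U : 'M[E]_(d, n + n)) : (y <= U)%MS -> U *m K *m adjmx s y = 0 ->
    exists2 r, U *m q = r *m U & \det r = t'.
  move=> yU Uy; have Uu : U *m u = 0 by rewrite -scalemxAr mulmxA Uy scaler0.
  have := stab_rank1 x v Uu yU; rewrite addrAC -scalemxAr mulmxA yx.
  by rewrite !mxE eqxx mulr1n -mulrA eps2 mulr1 [1 + (t' - 1)]addrC subrK.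
have triv d (U : 'M[E]_(d, n + n)) : U *m K *m adjmx s y = 0 ->
    U *m K *m adjmx s x = 0 -> U *m q = 1%:M *m U.
  by move=> Uy Ux; apply: stab_trivial; rewrite -scalemxAr mulmxA ?Ux ?Uy scaler0.
have LL : L *m K *m adjmx s L = 0.
  have /isom_grpP wK := mxgroupV (isom_mxgroup s K) wG.
  rewrite adjmxM adjmx_diag /L -!mulmxA [invmx w *m (K *m _)]mulmxA.
  by rewrite [invmx w *m K *m _]mulmxA wK mulmxA VKV.
have CS : col_mx S S0 *m K *m adjmx s S = 0.
  by rewrite adjS 2!mul_col_mx SKS S0KS col_mx0.
have MS : M *m K *m adjmx s S = 0.
  by rewrite adjS 2!mul_col_mx SKS -!mulmxA [V *m (K *m _)]mulmxA VKS !mulmxA Jba mul0mx col_mx0.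
have SSx : S *m K *m adjmx s S = 0 by rewrite adjS.
have xM d (x' : 'M[E]_(d, n + n)) : (x' <= S)%MS -> (x' <= M)%MS.
  by move=> h; apply: submx_trans h (sub_col_mxl _ _).
have xC d (x' : 'M[E]_(d, n + n)) : (x' <= S)%MS -> (x' <= col_mx S S0)%MS.
  by move=> h; apply: submx_trans h (sub_col_mxl _ _).
have DS : (a *m V <= S)%MS by rewrite -diag_dbl submxMl.
have s1 : s 1 = 1 := rmorph1 s.
have simp := (one, s1, divr1, divff nt, invr1, mulr1, mul1r).
have chit' : chi t' = (chi (s t))^-1 by rewrite (chiV chi0 chiM) // fmorph_eq0.
case=> [[xL xS Dy]|[xD yL Ly]|[xL xCS yM My]].
(* The determinant is [t] on [L], [X^sq] and [M], and 1 on [X^Delta]. *)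
- have [rL eL dL] := top _ _ xL (isotropic_sub LL xL).
  have [rS eS dS] := top _ _ xS (isotropic_sub SSx xS).
  have [rM eM dM] := top _ _ (xM _ _ xS) (isotropic_sub MS xS).
  have Dx : a *m V *m K *m adjmx s x = 0.
    by apply: (submx_mul0 DS); exact: isotropic_sub SSx xS.
  have full : (col_mx S S0 *m q <= col_mx S S0)%MS.
    have [r -> _] := top _ _ (xC _ _ xS) (isotropic_sub CS xS); exact: submxMl.
  apply: (violates_dets wG qG eS (triv _ _ Dy Dx) eM full eL).
  by rewrite nJ dL dS dM det1 !simp.
(* The determinant is [t'] on [L], and [t] on [X^Delta], [X^sq] and [M]. *)
- have xS := submx_trans xD DS.
  have [rL eL dL] := bot _ _ yL Ly.
  have [rS eS dS] := top _ _ xS (isotropic_sub SSx xS).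
  have [rM eM dM] := top _ _ (xM _ _ xS) (isotropic_sub MS xS).
  have Dx : a *m V *m K *m adjmx s x = 0.
    by apply: (submx_mul0 DS); exact: isotropic_sub SSx xS.
  have [rD eD dD] := top _ _ xD Dx.
  have full : (col_mx S S0 *m q <= col_mx S S0)%MS.
    have [r -> _] := top _ _ (xC _ _ xS) (isotropic_sub CS xS); exact: submxMl.
  apply: (violates_dets wG qG eS eD eM full eL).
  rewrite nJ dL dS dM dD chit' !simp; exact/nesym.
(* The determinant is [t] on [L], [t'] on [M], and 1 on [X^sq] and [X^Delta]. *)
- have [rL eL dL] := top _ _ xL (isotropic_sub LL xL).
  have Sy : S *m K *m adjmx s y = 0.
    by move: My; rewrite 2!mul_col_mx -col_mx0 => /eq_col_mx[].
  have Sx : S *m K *m adjmx s x = 0.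
    by apply: isotropic_sub xCS; rewrite form_swap CS adjmx0 scaler0.
  have Dx : a *m V *m K *m adjmx s x = 0.
    exact: submx_mul0 DS Sx.
  have Dy : a *m V *m K *m adjmx s y = 0.
    exact: submx_mul0 DS Sy.
  have [rM eM dM] := bot _ _ yM My.
  have MC : (M <= col_mx S S0)%MS.
    rewrite col_mx_sub sub_col_mxl -diag_dbl.
    by apply: submx_trans (submxMl _ _) (sub_col_mxr _ _).
  have full : (col_mx S S0 *m q <= col_mx S S0)%MS.
    by apply: stab_span => //; apply: submx_trans yM MC.
  apply: (violates_dets wG qG (triv _ _ Sy Sx) (triv _ _ Dy Dx) eM full eL).
  by rewrite nJ dL dM !det1 !simp chit'.
Qed.

Lemma isotropic_dual_vector d (U : 'M[E]_(d, n + n)) (x : 'rV[E]_(n + n)) :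
  ~~ (x <= U)%MS -> x *m K *m adjmx s x = 0 -> U *m K *m adjmx s x = 0 ->
  exists y : 'rV[E]_(n + n), [/\ U *m K *m adjmx s y = 0, x *m K *m adjmx s y = 1%:M
    & y *m K *m adjmx s y = 0].
Proof.
move=> nx xx Ux; have [y0 [Uy0 xy0]] := dual_vector nx.
pose be := (y0 *m K *m adjmx s y0) 0 0.
have beE : y0 *m K *m adjmx s y0 = be%:M by exact: mx11_scalar.
have sbe : s be = eps * be.
  have := form_swap y0 y0; rewrite beE /adjmx map_scalar_mx tr_scalar_mx scale_scalar_mx.
  move/matrixP/(_ 0 0); rewrite !mxE !eqxx !mulr1n => e.
  by rewrite {2}e mulrA eps2 mul1r.
have y0x : y0 *m K *m adjmx s x = eps%:M.
  by rewrite form_swap xy0 adjmx1 scale_scalar_mx mulr1.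
(* Adding a multiple of [x] keeps the pairings with [U] and [x]. By [sbe] both cross terms equal
   minus half of [be], which cancels the norm of [y0]. *)
pose co := - (2^-1 * be); exists (y0 + co *: x).
rewrite adjmxD adjmxZ; split.
- by rewrite mulmxDr -scalemxAr Uy0 Ux scaler0 addr0.
- by rewrite mulmxDr -scalemxAr xy0 xx scaler0 addr0.
rewrite !mulmxDl !mulmxDr -!scalemxAr -!scalemxAl beE xy0 xx y0x !scaler0 addr0.
rewrite !scale_scalar_mx mulr1 -!raddfD /=.
suff -> : be + s co * eps + co = 0 by rewrite raddf0.
rewrite /co rmorphN rmorphM fmorphV rmorph_nat sbe.
have -> : - (2^-1 * (eps * be)) * eps = - (2^-1 * be * (eps * eps)) by ring.
by rewrite eps2; field.
Qed.

End Nondegenerate.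

Lemma not_adapted_violates w : w \in G ->
  ~~ [&& (V *m invmx w :&: S <= a *m V)%MS, (a *m V <= V *m invmx w)%MS
       & (V *m invmx w :&: col_mx S S0 <= M)%MS] -> violates w.
Proof.
move=> wG; set L := V *m invmx w.
have uw := isom_grp_unit wG.
have fL : row_free L.
  by rewrite /row_free mxrankMfree ?row_free_unit ?unitmx_inv //; exact: row_free_diag.
have LL := form_L wG.
have DS : (a *m V <= S)%MS by rewrite -diag_dbl submxMl.
have SSx : S *m K *m adjmx s S = 0 by rewrite adjS.
have nonJ0 : J <> 0 -> J \in unitmx by case: degen => [[]|].
rewrite !negb_and => /or3P[] /row_subPn[i]; set x := row i _ => nx.
- have : (x <= L :&: S)%MS by exact: row_sub.
  rewrite sub_capmx => /andP[xL xS].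
  have [J00|/eqP/nonJ0 uJ] := eqVneq J 0.
    have [u [Du xu]] := separating_functional nx.
    by apply: (violates_zero wG J00 xu); constructor 1.
  have xx : x *m K *m adjmx s x = 0.
    by apply: (submx_mul0 xL); exact: isotropic_sub LL xL.
  have Dx : a *m V *m K *m adjmx s x = 0.
    by apply: (submx_mul0 DS); exact: isotropic_sub SSx xS.
  (* [X^Delta] need not be Lagrangian, so the dual vector has to be corrected to become
     isotropic. *)
  have [y [Dy xy yy]] := isotropic_dual_vector uJ nx xx Dx.
  by apply: (violates_pair uJ wG xy xx yy); constructor 1.
- have xD : (x <= a *m V)%MS by exact: row_sub.
  have [J00|/eqP/nonJ0 uJ] := eqVneq J 0.
    have [u [Lu xu]] := separating_functional nx.
    by apply: (violates_zero wG J00 xu); constructor 2.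
  have xS := submx_trans xD DS.
  have xx : x *m K *m adjmx s x = 0.
    by apply: (submx_mul0 xS); exact: isotropic_sub SSx xS.
  have [y [Ly xy]] := dual_vector uJ nx.
  (* A vector orthogonal to the Lagrangian [L] lies in [L], hence is isotropic; the same holds for
     [M] in the third case. *)
  have yL : (y <= L)%MS := lagrangian_max uJ LL fL erefl Ly.
  have yy : y *m K *m adjmx s y = 0.
    exact: submx_mul0 yL Ly.
  by apply: (violates_pair uJ wG xy xx yy); constructor 2.
- have : (x <= L :&: col_mx S S0)%MS by exact: row_sub.
  rewrite sub_capmx => /andP[xL xC].
  have [J00|/eqP/nonJ0 uJ] := eqVneq J 0.
    have [u [Mu xu]] := separating_functional nx.
    by apply: (violates_zero wG J00 xu); constructor 3.
  have xx : x *m K *m adjmx s x = 0.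
    by apply: (submx_mul0 xL); exact: isotropic_sub LL xL.
  have [y [My xy]] := dual_vector uJ nx.
  have yM : (y <= M)%MS := lagrangian_max uJ form_M row_free_M (dim_M uJ) My.
  have yy : y *m K *m adjmx s y = 0.
    exact: submx_mul0 yM My.
  by apply: (violates_pair uJ wG xy xx yy); constructor 3.
Qed.
End Transvection.

(** * Lagrangians in the double coset of 1 *)

Lemma dbl_span d e (A : 'M[E]_(d, n)) : A *m c^T = 0 ->
  forall B : 'M[E]_(e, d), (B *m A *m Z <= col_mx S S0)%MS.
Proof.
move=> Ac B; rewrite [A]expand_abc Ac mul0mx addr0 mulmxDr mulmxDl.
rewrite !mulmxA -[_ *m a *m Z]mulmxA -[_ *m b *m Z]mulmxA -!antidiag_dbl !mulmxA.
by rewrite addmx_sub // mulmx_sub ?sub_col_mxl ?sub_col_mxr.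
Qed.

Lemma adapted_graph w : w \in G -> (V *m invmx w :&: S <= a *m V)%MS ->
  (a *m V <= V *m invmx w)%MS -> (V *m invmx w :&: col_mx S S0 <= M)%MS ->
  exists q, [/\ q \in R, levX q = 1%:M, lev0 q = 1%:M & q *m w \in siegel s J].
Proof.
move=> wG; have LL := form_L wG; have uw := isom_grp_unit wG.
have fL : row_free (V *m invmx w).
  by rewrite /row_free mxrankMfree ?row_free_unit ?unitmx_inv //; exact: row_free_diag.
have Lw : V *m invmx w *m w = V by rewrite mulmxKV.
move: (V *m invmx w) LL fL Lw => L LL fL Lw LS DL LC.
have cancelZ d (x y : 'M[E]_(d, m)) : x *m antidiag E m = y *m diagmx m -> x = 0.
  move/(congr1 (mulmx^~ (antidiag E m)^T)); rewrite -!mulmxA antidiag_antidiagT.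
  rewrite diag_antidiagT mulmx0 -scalemxAr mulmx1 => /eqP.
  by rewrite scaler_eq0 (negPf two_neq0) => /eqP.
have cancelZn d (x : 'M[E]_(d, n)) : x *m Z *m Z^T = 0 -> x = 0.
  rewrite -mulmxA antidiag_antidiagT -scalemxAr mulmx1 => /eqP.
  by rewrite scaler_eq0 (negPf two_neq0) => /eqP.
(* [L] is orthogonal to [X^Delta], which pairs with [V^nabla] through [2 *: J], so the [V^nabla]
   part of a vector of [L] has no [Y] component. *)
have orthD d (x : 'M[E]_(d, n)) (y : 'M[E]_(d, n)) : ((y *m V + x *m Z)%R <= L)%MS ->
    x *m c^T = 0.
  move=> xL; apply: orthX_Y0.
  have : (y *m V + x *m Z) *m K *m adjmx s (a *m V) = 0.
    by apply: (submx_mul0 xL); exact: isotropic_sub LL DL.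
  rewrite adjmxM adjmx_diag adja mulmxA !mulmxDl -!mulmxA.
  rewrite [V *m (K *m _)]mulmxA [V *m K *m _]mulmxA VKV mul0mx mulmx0 add0r.
  rewrite [Z *m (K *m _)]mulmxA [Z *m K *m _]mulmxA ZKV -scalemxAl -scalemxAr => /eqP.
  by rewrite scaler_eq0 (negPf two_neq0) /= mulmxA => /eqP.
pose P1 := 2^-1 *: (L *m V^T); pose Q1 := 2^-1 *: (L *m Z^T).
have LE : L = P1 *m V + Q1 *m Z.
  rewrite -!scalemxAl -scalerDr -!mulmxA -mulmxDr diagT_add -scalemxAr mulmx1.
  by rewrite scalerA half2 scale1r.
(* A kernel vector of [P1] yields a vector of [L] in [V^nabla]. The three inclusions remove its [Y],
   [V_0] and [X] components in turn. *)
have uP : P1 \in unitmx.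
  rewrite -row_free_unit -kermx_eq0; set x := kermx P1.
  have xP : x *m P1 = 0 by exact: mulmx_ker.
  pose z := x *m Q1; have yE : x *m L = z *m Z by rewrite LE mulmxDr !mulmxA xP mul0mx add0r.
  have yL : (z *m Z <= L)%MS by rewrite -yE submxMl.
  have zc : z *m c^T = 0 by apply: (orthD _ z 0); rewrite mul0mx add0r.
  have yC : (z *m Z <= col_mx S S0)%MS by have := dbl_span zc 1%:M; rewrite mul1mx.
  have : (z *m Z <= M)%MS by apply: submx_trans LC; rewrite sub_capmx yL.
  case/submxP=> v; rewrite -[v]hsubmxK mul_row_col => ev.
  have zb : z *m b^T = 0.
    apply: (cancelZ _ _ (rsubmx v)); rewrite -mulmxA -antidiag_dblT mulmxA ev.
    by rewrite mulmxDl -!mulmxA SS0 mulmx0 add0r [b *m (V *m _)]mulmxA bVS0.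
  have yS : (z *m Z <= S)%MS.
    rewrite [z]expand_abc zb zc !mul0mx !addr0 -[_ *m a *m Z]mulmxA -antidiag_dbl mulmxA.
    exact: submxMl.
  have : (z *m Z <= a *m V)%MS by apply: submx_trans LS; rewrite sub_capmx yL.
  case/submxP=> v' ev'.
  have z0 : z = 0.
    by apply: cancelZn; rewrite ev' -!mulmxA diag_antidiagT !mulmx0.
  by have := yE; rewrite z0 mul0mx => /eqP; rewrite mulmx_free_eq0.
(* [L] is the graph of [ga], viewed as a map from [V^Delta] to [V^nabla]. *)
have [ga gaE] : exists ga, ga = invmx P1 *m Q1 by exists (invmx P1 *m Q1).
have LE' : V + ga *m Z = invmx P1 *m L.
  by rewrite gaE LE mulmxDr !mulmxA mulVmx // mul1mx.
(* Isotropy of the graph makes [ga] skew-adjoint for [J], which is what the isometry condition on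
   [q] requires. *)
have gJ : ga *m J + J *m adjmx s ga = 0.
  have : (V + ga *m Z) *m K *m adjmx s (V + ga *m Z) = 0.
    rewrite LE' adjmxM mulmxA -!mulmxA [L *m (K *m _)]mulmxA [L *m K *m _]mulmxA.
    by rewrite LL mul0mx mulmx0.
  rewrite adjmxD adjmxM adjmx_diag adjmx_antidiag !mulmxDl !mulmxDr VKV add0r.
  have -> : V *m K *m (Z^T *m adjmx s ga) = 2 *: (J *m adjmx s ga).
    by rewrite mulmxA VKZ -scalemxAl.
  have -> : ga *m Z *m K *m V^T = 2 *: (ga *m J).
    by rewrite -!mulmxA [Z *m (K *m _)]mulmxA ZKV -scalemxAr.
  have -> : ga *m Z *m K *m (Z^T *m adjmx s ga) = 0.
    by rewrite mulmxA -[ga *m Z *m K]mulmxA -[_ *m (Z *m K) *m _]mulmxA ZKZ mulmx0 mul0mx.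
  rewrite addr0 -scalerDr addrC => /eqP.
  by rewrite scaler_eq0 (negPf two_neq0) => /eqP.
have aga : a *m ga = 0.
  have /submxP[v ev] := DL; have ev1 : v *m P1 = a.
    rewrite -scalemxAr mulmxA -ev -mulmxA diag_diagT -scalemxAr mulmx1 scalerA half2.
    exact: scale1r.
  apply: cancelZn; rewrite -[a]ev1 gaE mulmxA mulmxK //.
  have -> : v *m Q1 *m Z = a *m V - v *m P1 *m V.
    by rewrite ev {1}LE mulmxDr !mulmxA addrC addKr.
  by rewrite ev1 subrr mul0mx.
have bL : ((b *m V + b *m ga *m Z)%R <= L)%MS.
  by rewrite -mulmxA -mulmxDr LE' mulmxA submxMl.
have bgc : b *m ga *m c^T = 0 by apply: (orthD _ _ b).
have bgb : b *m ga *m b^T = 0.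
  have : ((b *m V + b *m ga *m Z)%R <= M)%MS.
    apply: submx_trans LC; rewrite sub_capmx bL addmx_sub //.
      rewrite -diag_dbl; apply: submx_trans (submxMl _ _) (sub_col_mxr _ _).
    by have := dbl_span bgc 1%:M; rewrite mul1mx.
  case/submxP=> v; rewrite -[v]hsubmxK mul_row_col => ev.
  apply: (cancelZ _ _ (rsubmx v - 1%:M)); rewrite -[_ *m antidiag E m]mulmxA -antidiag_dblT mulmxA.
  have -> : b *m ga *m Z = lsubmx v *m S + rsubmx v *m (b *m V) - b *m V.
    by rewrite -ev addrC addKr.
  by rewrite mulmxBl mulmxDl -!mulmxA SS0 mulmx0 add0r [b *m (V *m _)]mulmxA bVS0 mulmxBl mul1mx.
(* This unipotent element fixes [V^nabla] and sends [V] to [V + ga *m Z]; the factor [2^-1] offsets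
   [V *m V^T = 2]. *)
pose q := 1%:M + V^T *m (2^-1 *: ga *m Z).
have Sq : S *m q = S.
  rewrite mulmxDr mulmx1 mulmxA dbl_diagT -!scalemxAl -scalemxAr -!mulmxA.
  by rewrite [a *m (ga *m _)]mulmxA aga mul0mx mulmx0 scaler0 addr0.
have S0q : S0 *m q = S0 + 2^-1 *: ((diagmx m)^T *m (b *m ga *m a^T *m antidiag E k)) *m S.
  rewrite mulmxDr mulmx1 mulmxA dbl_diagT -!scalemxAl -scalemxAr; congr (_ + _ *: _).
  rewrite -!mulmxA antidiag_dbl [b *m (ga *m _)]mulmxA {1}[b *m ga]expand_abc bgb bgc.
  by rewrite !mul0mx !addr0 -!mulmxA.
have Vq : V *m q = invmx P1 *m L.
  rewrite mulmxDr mulmx1 mulmxA diag_diagT -LE' -!scalemxAl -scalemxAr mul1mx scalerA.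
  by rewrite mulfV // scale1r.
have qG : q \in G.
  rewrite isom_grpE; apply/andP; split.
    rewrite unitmxE det_add1C -scalemxAl -scalemxAl -mulmxA antidiag_diagT mulmx0 scaler0.
    by rewrite addr0 det1 unitr1.
  apply/eqP; have qA : adjmx s q = 1%:M + 2^-1 *: (Z^T *m adjmx s ga *m V).
    rewrite adjmxD adjmx1 !adjmxM adjmxZ adjmx_antidiag fmorphV rmorph_nat.
    by rewrite adjVT -scalemxAr -scalemxAl.
  have qK : q *m K = K + 2^-1 *: (V^T *m (ga *m J) *m V).
    rewrite mulmxDl mul1mx -!scalemxAl -scalemxAr -scalemxAl; congr (_ + _ *: _).
    by rewrite -!mulmxA antidiag_form.
  rewrite qK qA mulmxDr mulmx1 -scalemxAr mulmxDl -scalemxAl.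
  have -> : K *m (Z^T *m adjmx s ga *m V) = V^T *m (J *m adjmx s ga) *m V.
    by rewrite !mulmxA form_antidiagT.
  have -> : V^T *m (ga *m J) *m V *m (Z^T *m adjmx s ga *m V) = 0.
    by rewrite !mulmxA -[_ *m V *m Z^T]mulmxA diag_antidiagT mulmx0 !mul0mx.
  rewrite scaler0 addr0 -addrA -scalerDr -mulmxDl -mulmxDr gJ mulmx0 mul0mx scaler0.
  exact: addr0.
exists q; split.
- rewrite parXE qG Sq submx_refl mul_col_mx Sq S0q col_mx_sub sub_col_mxl /=.
  by rewrite addmx_sub ?sub_col_mxr // mulmx_sub // sub_col_mxl.
- by rewrite levXdef Sq SS.
- by rewrite lev0def S0q mulmxDl S0S0 -[_ *m S *m _]mulmxA SS0 mulmx0 addr0.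
have gG := isom_mxgroup s K.
by rewrite inE (mxgroupM gG) //= mulmxA Vq -mulmxA Lw submxMl.
Qed.

Lemma double_coset_dichotomy w : (exists2 t, t != 0 & chi (t * s t) != 1) -> w \in G ->
  exists q, [/\ q \in R, levX q \in siegel s (0 : 'M[E]_k), lev0 q \in siegel s J0 &
    q *m w \in siegel s J \/ (invmx w *m q *m w \in siegel s J /\
      ps_factor s chi (J == 0) (invmx w *m q *m w) <>
      ps_factor s chi true (levX q) * ps_factor s chi (J0 == 0) (lev0 q))].
Proof.
move=> [t nt chit] wG.
have [/and3P[h1 h2 h3]|nadapted] := boolP [&& (V *m invmx w :&: S <= a *m V)%MS,
    (a *m V <= V *m invmx w)%MS & (V *m invmx w :&: col_mx S S0 <= M)%MS].
  have [q [qR qX q0 qwP]] := adapted_graph wG h1 h2 h3.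
  by exists q; rewrite qX q0 !(mxgroup1 (siegel_mxgroup _ _)); split=> //; left.
have [q [qR qX q0 bad]] := not_adapted_violates nt chit wG nadapted.
by exists q; split=> //; right.
Qed.

End Parabolic.

(** * Odd characteristic and the proof of one-dimensionality *)

Lemma two_neq0_of_odd_fixed (E : finFieldType) (s : {rmorphism E -> E}) :
  odd #|[set x : E | s x == x]| -> (2 : E) != 0.
Proof.
move=> oddF; set A := [set x : E | s x == x].
(* Translation by 1 permutes the fixed field, so its cardinality vanishes in [E]; an odd cardinality
   would be 1 if 2 were 0. *)
have sumA : \sum_(x in A) x = \sum_(x in A) x + #|A|%:R.
  rewrite {1}(reindex_inj (addIr 1)) /= (eq_bigl (mem A)) => [|x].
    by rewrite big_split /= sumr_const.
  by rewrite !inE rmorphD rmorph1 (inj_eq (addIr 1)).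
have A0 : #|A|%:R = 0 :> E by apply: (addrI (\sum_(x in A) x)); rewrite -sumA addr0.
apply: contra_eqT A0 => /negbNE/eqP two0.
rewrite -(odd_double_half #|A|) oddF natrD -muln2 natrM two0 mulr0 addr0.
exact: oner_neq0.
Qed.

Theorem mainTheorem2
  (E : finFieldType) (s : {rmorphism E -> E})
  (hs : forall x : E, s (s x) = x)
  (hq : odd #|[set x : E | s x == x]|)
  (C : closedFieldType)
  (hC : (#|[set x : E | s x == x]|%:R : C) != 0)
  (chi : E -> C)
  (hchi0 : forall x : E, x != 0 -> chi x != 0)
  (hchiM : forall x y : E, x != 0 -> y != 0 -> chi (x * y) = chi x * chi y)
  (hchi1q : exists2 x : E, x != 0 & chi (x * s x) != 1)
  (k m ky : nat) (J : 'M[E]_(k + m + ky)) (eps : E)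
  (heps : eps = 1 \/ eps = -1)
  (hepsE : (exists x : E, s x != x) -> eps = 1)
  (hJsym : J = eps *: (map_mx s J)^T)
  (hJ : (J = 0 /\ (ky = 0)%N) \/
        [/\ J \in unitmx,
            eXv k m ky *m J *m (eXv k m ky)^T = 0,
            eYv k m ky *m J *m (eYv k m ky)^T = 0 &
            [/\ eXv k m ky *m J *m (eV0v k m ky)^T = 0,
            eV0v k m ky *m J *m (eXv k m ky)^T = 0,
            eYv k m ky *m J *m (eV0v k m ky)^T = 0 &
            eV0v k m ky *m J *m (eYv k m ky)^T = 0]]) :
  exists T, [/\ intertwiner s chi J T,
                (exists2 f, degPS s chi J f & T f != 0) &
                forall T', intertwiner s chi J T' ->
                  exists c : C, forall f, degPS s chi J f ->
                    T' f = [ffun y => c * T f y]].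
Proof.
have two := two_neq0_of_odd_fixed hq.
have eps2 : eps * eps = 1 by case: heps => ->; rewrite ?mulrNN mulr1.
have seps : s eps = eps by case: heps => ->; rewrite ?rmorphN rmorph1.
(* The zero form satisfies the same Gram relations trivially, so one hypothesis set serves both
   cases. *)
have [Jaa [Jab [Jba [Jcc [Jcb [Jbc degen]]]]]] :
    eXv k m ky *m J *m (eXv k m ky)^T = 0 /\ eXv k m ky *m J *m (eV0v k m ky)^T = 0 /\
    eV0v k m ky *m J *m (eXv k m ky)^T = 0 /\ eYv k m ky *m J *m (eYv k m ky)^T = 0 /\
    eYv k m ky *m J *m (eV0v k m ky)^T = 0 /\ eV0v k m ky *m J *m (eYv k m ky)^T = 0 /\
    ((J = 0 /\ ky = 0%N) \/ J \in unitmx).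
  case: hJ => [[J00 ky0]|[? ? ? [? ? ? ?]]]; last by do !split=> //; right.
  by rewrite !{1}J00 !mulmx0 !mul0mx; do !split=> //; left.
apply: (@mackey_one_dim E C _ _ _ (isom_grp s (dbl_form J)) (siegel s J) (parX s J)
  (isom_grp s (dbl_form (0 : 'M[E]_k))) (siegel s (0 : 'M[E]_k))
  (isom_grp s (dbl_form (formV0 J))) (siegel s (formV0 J))
  (ps_factor s chi (J == 0)) (ps_factor s chi true) (ps_factor s chi (formV0 J == 0))
  (@levX E k m ky) (@lev0 E k m ky)).
- exact: isom_mxgroup.
- exact: siegel_mxgroup.
- exact: parX_mxgroup.
- exact: isom_mxgroup.
- exact: siegel_mxgroup.
- exact: isom_mxgroup.
- exact: siegel_mxgroup.
- by move=> p; rewrite inE => /andP[].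
- by move=> p; rewrite inE => /andP[].
- by move=> p; rewrite inE => /andP[].
- by move=> p; rewrite inE => /andP[].
- exact: siegel_mxchar.
- exact: siegel_mxchar.
- exact: siegel_mxchar.
- exact: levX_isom.
- exact: lev0_isom.
- exact: levXM.
- exact: lev0M.
- move=> r rP rR; have [rX r0] := siegel_par_levels Jaa Jab Jba rP rR.
  by split=> //; apply: siegel_par_char rP rR.
- exact: (levi_lift hs Jaa Jab Jba Jcc Jcb Jbc hJsym degen).
- move=> w wG; exact: (double_coset_dichotomy hs two Jaa Jab Jba Jcc Jcb Jbc eps2 seps
    hJsym degen hchi0 hchiM hchi1q wG).
Qed.
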